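(* Let $n\ge2$, $\mathfrak g=\mathfrak{gl}(n,\mathbb C)$, and let $G^*=GL(n,\mathbb C)^*$ be the dual Poisson Lie group with Lie algebra $\mathfrak g_{\rm st}^*$. For $(x,y)\in\mathfrak g_{\rm st}^*$ put $u=x-y$, and use the entries of $u$ as local holomorphic coordinates on $G^*$ near $(\mathbf 1_n,\mathbf 1_n)$ via $(x,y)\mapsto(\exp x,\exp y)$ and as linear coordinates on $\mathfrak g_{\rm st}^*$. All functions below are restricted to $G^*$, and lowest degree terms are taken at $(\mathbf 1_n,\mathbf 1_n)$. Indices $p,i$ in $\varphi_{p(n-1)+i}$ range over $p\in[0,n-2]$, $i\in[1,n-1]$. 1) The set $$\{\varphi_{p(n-1)+i}^{\rm low}:i\le p+1\}\cup\{\overline c_i^{\rm low}:0\le i\le n-1\}$$ is a polynomial integrable system on $(\mathfrak g_{\rm st}^*,\pi_{0,\mathfrak g})$. 2) Let $F(u)=\begin{bmatrix}ue_1&u^2e_1&\cdots&u^ne_1\end{bmatrix}$ with $e_1=[1\ 0\ \cdots\ 0]^T\in\mathbb C^n$. Up to a sign, $$\varphi_{p(n-1)+i}^{\rm low}(u)=\Delta_{[i+1,\,n-p+i-1],\,[1,\,n-p-1]}(F(u))\quad\text{for all } i\le p+1,$$ $$\overline c_i^{\rm low}(u)=\text{the sum of the principal }(n-i)\times(n-i)\text{ minors of }u\quad\text{for all }0\le i\le n-1.$$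
   Context: Let $B$ (resp. $B_-$) be the group of upper (resp. lower) triangular matrices in $GL(n,\mathbb C)$, with Lie algebras $\mathfrak b,\mathfrak b_-$. $G^*=\{(X,Y)\in B\times B_-:[X]_0[Y]_0=\mathbf 1_n\}$, where $[\cdot]_0$ is the diagonal part and $\mathbf 1_n$ the identity matrix; its Lie algebra is $\mathfrak g_{\rm st}^*=\{(x,y)\in\mathfrak b\times\mathfrak b_-:\text{ diagonal of }x=-\text{ diagonal of }y\}$, so $(x,y)\mapsto u=x-y$ is a linear isomorphism $\mathfrak g_{\rm st}^*\to\mathfrak{gl}(n,\mathbb C)$. $\pi_{0,\mathfrak g}$ is the Kirillov–Kostant–Souriau Poisson structure on $\mathfrak g^*$ (with $\{a,b\}=[a,b]$ for $a,b\in\mathfrak g$ as linear functions), transported to $\mathfrak g_{\rm st}^*$ via $\mathfrak g_{\rm st}^*\cong\mathfrak g^*$, $(x,y)\mapsto(a\mapsto{\rm tr}((x-y)a))$. (It is the linearization at the identity of the dual Poisson structure on $G^*$.) A polynomial integrable system on it is a set of $n^2-\frac12{\rm rk}(\pi_{0,\mathfrak g})$ algebraically independent polynomials that pairwise Poisson commute. For a matrix $A$, $A_{[i,j]}^{[k,l]}$ is the submatrix with rows $[i,j]$ and columns $[k,l]$; $A_{[i,j]}$ has rows $[i,j]$ and all columns; $\Delta_{I,J}(A)$ is the determinant of the submatrix with rows $I$ and columns $J$. For $(X,Y)\in B\times B_-$, $\Psi$ is the $(n-1)^2\times(n-1)^2$ matrix with $n-1$ block rows and $n-1$ block columns having blocks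 $Y_{[2,n]}$ in positions $(a,a)$ for $a\le n-2$, block $Y_{[2,n]}^{[1,1]}$ in position $(n-1,n-1)$, blocks $X_{[2,n]}$ in positions $(a+1,a)$, $1\le a\le n-2$, and zeros elsewhere. For $k\in[1,(n-1)^2]$, $\varphi_k(X,Y)=\det\Psi_{[k,(n-1)^2]}^{[k,(n-1)^2]}$. For $i\in[0,n]$, $\overline c_i$ is defined by $\det((\lambda-1)\mathbf 1_n+XY^{-1})=\sum_{i=0}^n\overline c_i(X,Y)\lambda^i$. Lowest degree term: for a non-zero holomorphic function near $(\mathbf 1_n,\mathbf 1_n)$ in $G^*$, the homogeneous polynomial formed by the terms of smallest total degree in its Taylor expansion in the entries of $u$. *)

(* Defs.v *)
From HB Require Import structures.
From mathcomp Require Import all_boot all_order all_algebra.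
From mathcomp Require Import complex mpoly.
From mathcomp Require Import boolp classical_sets reals topology normedtype.
From mathcomp Require Import sequences.

Set Implicit Arguments.
Unset Strict Implicit.
Unset Printing Implicit Defensive.

Import Order.TTheory GRing.Theory Num.Theory.
Import numFieldNormedType.Exports.

Local Open Scope classical_set_scope.
Local Open Scope ring_scope.

(* The scalar field is a generic numFieldType [K] only so that the standard
   topology of [K] and ['M[K]_n] is inferred; it is meant to be [R[i]] for
   [R : realType]. *)

(* Entry (i, j) with indices starting at 1, and 0 out of range. *)
Definition ent (T : nmodType) (m n : nat) (A : 'M[T]_(m, n)) (i j : nat) : T :=
  if [pick ab : 'I_m * 'I_n | (ab.1.+1 == i) && (ab.2.+1 == j)] is Some ab
  then A ab.1 ab.2 else 0.

(* $\Delta_{[i, j], [k, k + j - i]}(A)$, with indices starting at 1. *)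
Definition Delta (T : comNzRingType) (m n : nat) (A : 'M[T]_(m, n))
    (i j k : nat) : T :=
  \det (\matrix_(a < j.+1 - i, b < j.+1 - i) ent A (i + a) (k + b)).

Definition sum_principal_minors (T : comNzRingType) (n : nat) (A : 'M[T]_n)
    (k : nat) : T :=
  \sum_(I : {set 'I_n} | #|I| == k)
    \det (mxsub (@enum_val _ (mem I)) (@enum_val _ (mem I)) A).

(* Blocks numbered from 0: row r lies in block row a at inner position i, and
   column s in block column b at inner position j.  All block columns have
   width n, except the last one (b = n - 2), which only has its first column;
   hence the block Y_{[2,n]}^{[1,1]} is covered by the case a == b.  Inner
   position i is row i + 2 of X or Y in the numbering from 1. *)
Definition Psi (T : nmodType) (n : nat) (X Y : 'M[T]_n) :
    'M[T]_(n.-1 ^ 2) :=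
  \matrix_(r, s)
    let a := (r %/ n.-1)%N in let i := (r %% n.-1)%N in
    let b := (s %/ n)%N in let j := (s %% n)%N in
    if a == b then ent Y i.+2 j.+1
    else if a == b.+1 then ent X i.+2 j.+1
    else 0.

Definition phi (T : comNzRingType) (n k : nat) (X Y : 'M[T]_n) : T :=
  Delta (Psi X Y) k (n.-1 ^ 2) k.

Definition cbar (T : comUnitRingType) (n i : nat) (X Y : 'M[T]_n) : T :=
  (\det (('X - 1)%:M + map_mx polyC (X *m invmx Y)))`_i.

Definition Fmx (T : pzRingType) (n : nat) (u : 'M[T]_n) : 'M[T]_n :=
  let e1 : 'cV[T]_n := \col_i (i == 0 :> nat)%:R in
  \matrix_(i, j) (u ^+ j.+1 *m e1) i ord0.

(* Polynomials on gl(n): the variable of index [mxvec_index i j] is the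
   coordinate u_ij. *)
Notation glpoly K n := {mpoly K[n * n]} (only parsing).

Definition gleval (K : comNzRingType) (n : nat) (p : glpoly K n)
    (u : 'M[K]_n) : K :=
  p.@[fun k => mxvec u ord0 k].

Definition coordmx (K : comNzRingType) (n : nat) : 'M[glpoly K n]_n :=
  \matrix_(i, j) 'X_(mxvec_index i j).

(* The function u |-> tr(u a) is the element a of g, viewed as a linear
   function on g^*. *)
Definition linfun_of (K : comNzRingType) (n : nat) (a : 'M[K]_n) : glpoly K n :=
  \tr (coordmx K n *m map_mx (@mpolyC (n * n) K) a).

(* The differential of f, as an element of g: the coefficient of the elementary
   matrix E_ij is df/du_ji, because u_ji = tr(u E_ij). *)
Definition gradmx (K : comNzRingType) (n : nat) (f : glpoly K n) :
    'M[glpoly K n]_n :=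
  \matrix_(i, j) f^`M(mxvec_index j i).

(* {f, g}(u) = tr(u [df, dg]) *)
Definition kks (K : comNzRingType) (n : nat) (f g : glpoly K n) : glpoly K n :=
  \tr (coordmx K n *m (gradmx f *m gradmx g - gradmx g *m gradmx f)).

Lemma mderiv_coord (K : comNzRingType) (n : nat) (a : K) (i j k l : 'I_n) :
  ('X_(mxvec_index k l) * a%:MP : glpoly K n)^`M(mxvec_index j i) =
  ((k == j) && (l == i))%:R * a%:MP.
Proof.
rewrite mulrC mul_mpolyC mderivZ mderivX mnm1E.
have klE : (mxvec_index k l == mxvec_index j i) = (k == j) && (l == i).
  apply/eqP/andP => [|[/eqP-> /eqP->] //].
  by move/cast_ord_inj/enum_rank_inj => [-> ->].
rewrite klE; case: andP => [[/eqP-> /eqP->]|_]; last by rewrite mulr0n scale0r scaler0 mul0r.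
have -> : (U_(mxvec_index j i) - U_(mxvec_index j i) = 0 :> 'X_{1..n * n})%MM.
  by apply/mnmP => h; rewrite mnmBE mnm0E subnn.
by rewrite mpolyX0 scale1r mul1r -mul_mpolyC mulr1.
Qed.

Lemma gradmx_linfun_of (K : comNzRingType) (n : nat) (a : 'M[K]_n) :
  gradmx (linfun_of a) = map_mx (@mpolyC (n * n) K) a.
Proof.
apply/matrixP=> i j; rewrite !mxE /linfun_of /mxtrace raddf_sum /=.
under eq_bigr => k _.
  rewrite mxE raddf_sum /=.
  under eq_bigr => l _ do rewrite !mxE mderiv_coord.
  over.
rewrite (bigD1 j) //= (bigD1 i) //= !eqxx mul1r.
rewrite big1 ?addr0 => [|l /negPf->]; last by rewrite andbF mul0r.
rewrite big1 ?addr0 // => k /negPf kj.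
by rewrite big1 // => l _; rewrite kj mul0r.
Qed.

Lemma kks_linfun_of (K : comNzRingType) (n : nat) (a b : 'M[K]_n) :
  kks (linfun_of a) (linfun_of b) = linfun_of (a *m b - b *m a).
Proof.
by rewrite /kks !gradmx_linfun_of /linfun_of -!map_mxM -map_mxB.
Qed.

(* The rank of a Poisson structure is its maximal rank over all points. *)
Definition kks_rank (K : fieldType) (n : nat) : nat :=
  let Pi (u : 'M[K]_n) : 'M[K]_(n * n) :=
    \matrix_(k, l) gleval (kks 'X_k 'X_l) u in
  \max_(r < (n * n).+1 | `[< exists u : 'M[K]_n, \rank (Pi u) = r >]) r.

Definition alg_indep (K : comNzRingType) (m N : nat)
    (s : N.-tuple {mpoly K[m]}) : Prop :=
  forall Q : {mpoly K[N]}, Q \mPo s = 0 -> Q = 0.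

Definition polynomial_integrable_system (K : fieldType) (n : nat)
    (S : set (glpoly K n)) : Prop :=
  exists s : (n ^ 2 - (kks_rank K n)./2).-tuple (glpoly K n),
    [/\ S = [set f | f \in s],
        alg_indep s &
        forall f g, S f -> S g -> kks f g = 0].

Section LowestDegree.
Variables (K : numFieldType) (n : nat).

Definition expmx (x : 'M[K]_n) : 'M[K]_n :=
  lim ([series (k`!%:R)^-1 *: x ^+ k]_k @ \oo).

Definition in_gst (x y : 'M[K]_n) : Prop :=
  [/\ is_trig_mx x^T, is_trig_mx y & forall i, x i i = - y i i].

(* [P k] is the sum of the terms of total degree k of the Taylor expansion at
   (1, 1) of the restriction of f to G^*, in the chart
   u = x - y |-> (exp x, exp y), which sends a neighbourhood of 0 onto a
   neighbourhood of (1, 1) in G^*.  Such a P is unique: restrict the series to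
   the lines through 0. *)
Definition taylor_expansion (f : 'M[K]_n -> 'M[K]_n -> K)
    (P : nat -> glpoly K n) : Prop :=
  (forall k, P k \is k.-homog) /\
  \forall u \near (0 : 'M[K]_n), forall x y, in_gst x y -> x - y = u ->
    [series gleval (P k) u]_k @ \oo --> f (expmx x) (expmx y).

Definition is_low (f : 'M[K]_n -> 'M[K]_n -> K) (q : glpoly K n) : Prop :=
  exists P d, [/\ taylor_expansion f P, forall k, (k < d)%N -> P k = 0,
                  P d != 0 & q = P d].

(* 0 if f has no Taylor expansion, or if f vanishes near (1, 1). *)
Definition low (f : 'M[K]_n -> 'M[K]_n -> K) : glpoly K n :=
  xget 0 [set q | is_low f q].

End LowestDegree.

(* Main.v *)
Require Import Defs.
From mathcomp Require Import all_boot all_order all_algebra perm.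
From mathcomp Require Import complex mpoly.
From mathcomp Require Import boolp classical_sets reals topology normedtype sequences.
From mathcomp Require Import zify ring lra.
Set Implicit Arguments.
Unset Strict Implicit.
Unset Printing Implicit Defensive.
Import Order.TTheory GRing.Theory Num.Theory.
Import numFieldNormedType.Exports.
Local Open Scope classical_set_scope.
Local Open Scope ring_scope.

(** Put [Z = X^-1 Y] for a point [(X, Y)] of the dual group.

    The minors [phi].  [Psi] is a staircase: [X] stands to the left of each block [Y].
    Because [X (- Z) v + Y v = 0], a unitriangular change of columns clears almost all of
    it, and reordering the columns makes the trailing minor block triangular, with diagonal
    entries of [X] on one part of the diagonal.  What remains is a minor of the matrix with
    columns [(Z - 1) e_1, (Z - 1)^2 e_1, ...], so that [phi] is, up to sign, a product of
    diagonal entries of [X] times [Delta (Fmx (Z - 1))] ([phi_factorization]).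

    Lowest terms.  In the chart [u = x - y] one has [X^-1 Y - 1 = - u + ...] and
    [X Y^-1 - 1 = u + ...].  Column [j] of [Fmx] then vanishes to order [j], and in the
    Leibniz formula all the products have the same order; hence the lowest term of the
    determinant is the determinant of the lowest terms ([has_exp_det]), as long as this is
    not zero ([low_phi]).  The coefficient [cbar] is a sum of principal minors of
    [X Y^-1 - 1], to which the same argument applies ([low_cbar]).  Expansions are handled
    through series that converge with an explicit rate ([wsum], [has_exp]), which makes sums
    and products elementary; they are unique ([taylor_unique]) since a power series
    vanishing near 0 has no nonzero coefficient.

    Commutation.  The bracket of two entries of the powers of [u], taken in the same column,
    is a sum of 2 x 2 determinants of such entries ([kks_pow]).  Expanding the bracket of
    two minors by Jacobi's formula, each term replaces a column of one of the minors by
    another column of the same minor, and is zero ([kks_flag_minors]); here the rows must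
    avoid the first one, so that the identity matrix does not contribute.  The coefficients
    of the characteristic polynomial are Casimir functions ([kks_char_coef]).

    Independence.  Every family of nonzero values of the minors, together with every
    characteristic polynomial, occurs at some [u = g C g^-1] with [C] a companion matrix
    ([realize_system]); hence a polynomial relation vanishes at all points with nonzero
    coordinates, and is trivial ([mpoly_nonvanishing]).

    Counting.  The rank of the Poisson structure is [n^2 - n] ([kks_rank_eq]): it is at
    least that at a diagonal matrix with distinct entries, and at most that at the points
    with a cyclic vector, where the powers of [u] are [n] independent elements of the kernel;
    these points are dense.  So [n (n + 1) / 2] functions are needed, and these are the
    [n (n - 1) / 2] minors and the [n] Casimir functions. *)

(** * Nonvanishing of polynomials at points *)

Lemma poly_nonroot (K : numFieldType) (p : {poly K}) :
  p != 0 -> exists2 x : K, x != 0 & p.[x] != 0.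
Proof.
move=> p0; pose rs := [seq k.+1%:R : K | k <- iota 0 (size p)].
have [|/allPn[x /mapP[k _ ->] xp]] := boolP (all (root p) rs); last first.
  by exists k.+1%:R; rewrite ?pnatr_eq0.
move=> rts; have := max_poly_roots p0 rts.
rewrite map_inj_uniq ?iota_uniq => [|j k /eqP]; last first.
  by rewrite eqr_nat eqSS => /eqP.
by rewrite size_map size_iota ltnn => /(_ isT).
Qed.

Lemma base_expansion_inj (M n : nat) (f g : nat -> nat) :
  (forall i, f i < M)%N -> (forall i, g i < M)%N ->
  (\sum_(i < n) f i * M ^ i = \sum_(i < n) g i * M ^ i)%N ->
  forall i, (i < n)%N -> f i = g i.
Proof.
move=> fM gM; elim: n f g fM gM => // n IH f g fM gM.
rewrite !big_ord_recl /= !expn0 !muln1.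
have S h : (\sum_(i < n) h (bump 0 i) * M ^ bump 0 i =
            (\sum_(i < n) h i.+1 * M ^ i) * M)%N.
  by rewrite big_distrl /=; apply: eq_bigr => i _; rewrite /bump add1n expnSr mulnA.
rewrite !S => E.
have f0 : f 0%N = g 0%N.
  by move/(congr1 (modn^~ M)): E; rewrite ![(_ + _ * M)%N]addnC !modnMDl !modn_small.
move: E; rewrite f0 => /addnI E [|i] // iltn.
apply: (IH (fun i => f i.+1) (fun i => g i.+1)) => //.
by move: E => /eqP; rewrite eqn_pmul2r ?(leq_ltn_trans _ (fM 0%N)) // => /eqP.
Qed.

(** Substituting t ^ (M ^ i) for the i-th variable, M larger than all the
    exponents, maps distinct monomials to distinct powers of t. *)
Lemma mpoly_nonvanishing (K : numFieldType) (n : nat) (p : {mpoly K[n]}) :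
  p != 0 -> exists2 v : 'I_n -> K, (forall i, v i != 0) & p.@[v] != 0.
Proof.
move=> p0; pose M := msize p.
pose e (m : 'X_{1..n}) := (\sum_(i < n) m i * M ^ i)%N.
have dM m i : m \in msupp p -> (m i < M)%N.
  move=> mp; apply: leq_ltn_trans (msize_mdeg_lt mp).
  by rewrite mdegE (bigD1 i) //= leq_addr.
have einj : {in msupp p &, injective e}.
  move=> m m' mp mp' E; apply/mnmP => i.
  have M0 : (0 < M)%N by apply: leq_ltn_trans (dM _ i mp).
  pose x (m : 'X_{1..n}) k := if insub k is Some j then m j else 0%N.
  have xE m0 (j : 'I_n) : x m0 j = m0 j by rewrite /x valK.
  have xM m0 k : m0 \in msupp p -> (x m0 k < M)%N.
    by rewrite /x; case: insubP => [j _ _ /dM ->|].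
  rewrite -!xE; apply: (@base_expansion_inj M n) => // [k|k|].
  - exact: xM.
  - exact: xM.
  - by under eq_bigr do rewrite xE; under [RHS]eq_bigr do rewrite xE.
pose q : {poly K} := \sum_(m <- msupp p) p@_m *: 'X^(e m).
have q0 : q != 0.
  have := p0; rewrite -msupp_eq0; case E: (msupp p) => [//|m0 s] _.
  have m0p : m0 \in msupp p by rewrite E mem_head.
  apply/eqP => /(congr1 (fun r : {poly K} => r`_(e m0))).
  rewrite coef0 coef_sum (bigD1_seq m0) ?msupp_uniq //= coefZ coefXn eqxx mulr1.
  rewrite big_seq_cond big1 ?addr0 => [/eqP|m /andP[mp mm0]].
    by move: m0p; rewrite mcoeff_msupp => /negPf ->.
  by rewrite coefZ coefXn (inj_in_eq einj) // eq_sym (negPf mm0) mulr0.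
have [t t0 qt] := poly_nonroot q0.
exists (fun i => t ^+ (M ^ i)%N) => [i|]; first by rewrite expf_neq0.
rewrite mevalE.
have -> // :
  \sum_(m <- msupp p) p@_m * \prod_(i < n) (t ^+ (M ^ i)%N) ^+ m i = q.[t].
rewrite /q horner_sum; apply: eq_bigr => m _.
rewrite hornerZ hornerXn /e; congr (_ * _).
rewrite (big_morph (fun k => t ^+ k) (exprD t) (expr0 t)).
by apply: eq_bigr => i _; rewrite -exprM mulnC.
Qed.

(** * Series converging at a geometric rate *)

(** The series [a] converges to [s], absolutely and even with the weights [2 ^ k].  The
    weights give an explicit rate of convergence, which makes the product theorem
    elementary: the terms of a double series outside the triangle [i + j < N] weigh at
    most [2 ^ - N] times a constant. *)
Definition wsum (K : numFieldType) (a : nat -> K) (s : K) : Prop :=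
  exists C : K, forall N : nat,
    \sum_(k < N) `|a k| * 2 ^+ k <= C /\
    `|s - \sum_(k < N) a k| * 2 ^+ N <= C.

Section WSum.
Variable K : numFieldType.
Implicit Types (a b : nat -> K) (s t : K).

Definition cauchy_prod (R : pzSemiRingType) (a b : nat -> R) (k : nat) : R :=
  \sum_(j < k.+1) a j * b (k - j)%N.

Lemma wsum_ext a b s : a =1 b -> wsum a s -> wsum b s.
Proof.
move=> ab [C HC]; exists C => N; have [h1 h2] := HC N.
split; first by under eq_bigr do rewrite -ab.
by under eq_bigr do rewrite -ab.
Qed.

Lemma wsum_add a b s t : wsum a s -> wsum b t -> wsum (fun k => a k + b k) (s + t).
Proof.
move=> [C HC] [D HD]; exists (C + D) => N.
have [c1 c2] := HC N; have [d1 d2] := HD N; split.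
  apply: le_trans (lerD c1 d1); rewrite -big_split /=.
  by apply: ler_sum => k _; rewrite -mulrDl ler_wpM2r ?exprn_ge0 ?ler_normD.
apply: le_trans (lerD c2 d2); rewrite -mulrDl ler_wpM2r ?exprn_ge0 //.
by rewrite big_split /= opprD addrACA ler_normD.
Qed.

Lemma wsum_const (c : K) : wsum (fun k => if k == 0%N then c else 0) c.
Proof.
exists `|c| => -[|N].
  by rewrite !big_ord0 subr0 expr0 mulr1 lexx normr_ge0.
rewrite !big_ord_recl /= !big1 => [|i _|i _]; rewrite ?normr0 ?mul0r //.
by rewrite !addr0 subrr normr0 mul0r mulr1 lexx normr_ge0.
Qed.

Lemma cauchy_prod_triangle (R : pzSemiRingType) (a b : nat -> R) N :
  \sum_(k < N) cauchy_prod a b k =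
  \sum_(i < N) \sum_(j < N | (i + j < N)%N) a i * b j.
Proof.
rewrite /cauchy_prod.
under eq_bigr => k _ do
  rewrite (big_ord_widen N (fun j : nat => a j * b (k - j)%N)) ?ltn_ord //.
rewrite (exchange_big_dep xpredT) //=; apply: eq_bigr => i _.
rewrite -(big_mkord (fun k : nat => i < k.+1)%N (fun k : nat => a i * b (k - i)%N)).
rewrite -(big_mkord (fun j : nat => i + j < N)%N (fun j : nat => a i * b j)).
rewrite (big_cat_nat (n := i)) ?(ltnW (ltn_ord i)) //=.
rewrite big_nat_cond big_pred0 ?add0r => [|k]; last by lia.
rewrite big_nat_cond (eq_bigl (fun k => (i <= k < N)%N)) => [|k]; last by lia.
rewrite -big_nat -{1}(add0n i) big_addn.
rewrite [RHS](big_cat_nat (n := N - i)) ?leq_subr //=.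
rewrite [X in _ = _ + X]big_nat_cond [X in _ = _ + X]big_pred0 ?addr0 => [|k]; last by lia.
rewrite [RHS]big_nat_cond [LHS]big_nat_cond; apply: eq_big => [k|k _]; first by lia.
by rewrite addnK.
Qed.

Lemma wsum_mul a b s t :
  wsum a s -> wsum b t -> wsum (cauchy_prod a b) (s * t).
Proof.
move=> [C HC] [D HD].
have C0 : 0 <= C by have [+ _] := HC 0%N; rewrite big_ord0.
have D0 : 0 <= D by have [+ _] := HD 0%N; rewrite big_ord0.
pose A k := `|a k| * 2 ^+ k; pose B k := `|b k| * 2 ^+ k.
have A0 k : 0 <= A k by rewrite mulr_ge0 ?exprn_ge0.
have B0 k : 0 <= B k by rewrite mulr_ge0 ?exprn_ge0.
have AB N : (\sum_(i < N) A i) * (\sum_(j < N) B j) <= C * D.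
  by apply: ler_pM; rewrite ?sumr_ge0 ?(HC N).1 ?(HD N).1.
have hC N : `|s - \sum_(k < N) a k| * 2 ^+ N <= C by have [] := HC N.
have hD N : `|t - \sum_(k < N) b k| * 2 ^+ N <= D by have [] := HD N.
have tD : `|t| <= D by have := hD 0%N; rewrite big_ord0 subr0 mulr1.
have AN N : `|\sum_(k < N) a k| <= C.
  apply: le_trans (HC N).1; apply: le_trans (ler_norm_sum _ _ _) _.
  by apply: ler_sum => k _; rewrite ler_peMr ?exprn_ege1 ?ler1n.
exists (C * D + C * D + C * D) => N; split.
  apply: (@le_trans _ _ (C * D)); last by rewrite lerDr addr_ge0 ?mulr_ge0.
  apply: le_trans (AB N).
  apply: (@le_trans _ _ (\sum_(k < N) cauchy_prod A B k)).
    apply: ler_sum => k _; rewrite /cauchy_prod.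
    apply: (@le_trans _ _ ((\sum_(j < k.+1) `|a j * b (k - j)%N|) * 2 ^+ k)).
      by rewrite ler_wpM2r ?exprn_ge0 ?ler_norm_sum.
    rewrite mulr_suml; apply: ler_sum => j _; rewrite /A /B normrM.
    have jk : (j <= k)%N by rewrite -ltnS.
    have E2 : 2 ^+ k = 2 ^+ j * 2 ^+ (k - j) :> K by rewrite -exprD subnKC.
    by rewrite E2 mulrACA.
  rewrite cauchy_prod_triangle big_distrlr /=; apply: ler_sum => i _.
  by rewrite big_mkcond /=; apply: ler_sum => j _; case: ifP => // _; rewrite mulr_ge0.
set Aa := \sum_(k < N) a k; set Bb := \sum_(k < N) b k.
have -> : s * t - \sum_(k < N) cauchy_prod a b k =
  (s - Aa) * t + Aa * (t - Bb) + (Aa * Bb - \sum_(k < N) cauchy_prod a b k).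
  by ring.
apply: (@le_trans _ _ ((`|s - Aa| * `|t| + `|Aa| * `|t - Bb| +
   `|Aa * Bb - \sum_(k < N) cauchy_prod a b k|) * 2 ^+ N)).
  rewrite ler_wpM2r ?exprn_ge0 // -!normrM.
  by apply: le_trans (ler_normD _ _) _; rewrite lerD2r ler_normD.
rewrite 2!mulrDl; apply: lerD; first apply: lerD.
- by rewrite mulrAC; apply: (ler_pM _ _ (hC N) tD); rewrite ?mulr_ge0 ?exprn_ge0 ?normr_ge0.
- by rewrite -mulrA; apply: (ler_pM _ _ (AN N) (hD N)); rewrite ?mulr_ge0 ?exprn_ge0 ?normr_ge0.
apply: le_trans (AB N); rewrite cauchy_prod_triangle !big_distrlr /= -sumrB.
apply: (@le_trans _ _ ((\sum_(i < N) `|\sum_(j < N) a i * b j -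
   \sum_(j < N | (i + j < N)%N) a i * b j|) * 2 ^+ N)).
  by rewrite ler_wpM2r ?exprn_ge0 ?ler_norm_sum.
rewrite mulr_suml; apply: ler_sum => i _.
rewrite (bigID (fun j : 'I_N => i + j < N)%N) /= addrAC subrr add0r.
apply: (@le_trans _ _ ((\sum_(j < N | ~~ (i + j < N)%N) `|a i * b j|) * 2 ^+ N)).
  by rewrite ler_wpM2r ?exprn_ge0 ?ler_norm_sum.
rewrite mulr_suml big_mkcond; apply: ler_sum => j _; case: ifP => [ij|_].
  rewrite /A /B mulrACA normrM ler_wpM2l ?mulr_ge0 // -exprD.
  by rewrite ler_weXn2l ?ler1n // leqNgt.
by rewrite mulr_ge0.
Qed.

Lemma sum_half_powers_le N : \sum_(k < N) (2^-1 : K) ^+ k <= 2.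
Proof.
have -> : \sum_(k < N) (2^-1 : K) ^+ k = 2 - 2 * 2^-1 ^+ N.
  elim: N => [|N IH]; first by rewrite big_ord0; ring.
  by rewrite big_ord_recr /= IH exprS; field.
by rewrite lerBlDr lerDl mulr_ge0 ?exprn_ge0 ?invr_ge0.
Qed.

End WSum.

Section ComplexWSum.
Variable R : realType.
Local Notation C := R[i].
Implicit Types (a b : nat -> C).

(** The archimedean property of [R[i]], in the form in which the rates of convergence use
    it. *)
Lemma complex_pow2_dominates (c e : C) : 0 <= c -> 0 < e ->
  exists N, forall m, (N <= m)%N -> c <= e * 2 ^+ m.
Proof.
move=> c0 e0; have er : e = (complex.Re e)%:C%C by rewrite RRe_real ?gtr0_real.
have cr : c = (complex.Re c)%:C%C by rewrite RRe_real ?ger0_real.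
set x := complex.Re e in er *; set y := complex.Re c in cr *.
have x0 : 0 < x by rewrite -ltcR -er.
exists (Num.Def.archi_bound (y / x)) => m Nm.
rewrite er [c]cr; have -> : (2 : C) = (2 : R)%:C%C by rewrite rmorphMn rmorph1.
rewrite -rmorphXn -rmorphM /= lecR mulrC -ler_pdivrMr //.
have y0 : 0 <= y by rewrite -lecR -cr.
apply: ltW; apply: (lt_le_trans (archi_boundP _)); first by rewrite divr_ge0 // ltW.
apply: (@le_trans _ _ (m%:R)); first by rewrite ler_nat.
by rewrite -natrX ler_nat ltnW // ltn_expl.
Qed.

(** The partial sums lie between an increasing and a decreasing sequence, so that the
    supremum of the first one is the sum of the series, with an explicit rate. *)
Lemma real_geometric_sum (x : nat -> R) : (forall k, `|x k| <= 4^-1 ^+ k) ->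
  exists s, forall N, `|s - \sum_(k < N) x k| <= 2 * 4^-1 ^+ N.
Proof.
move=> xb; pose S N := \sum_(k < N) x k.
pose L N := S N - 2 * 4^-1 ^+ N; pose U N := S N + 2 * 4^-1 ^+ N.
have e0 N : 0 <= (4^-1 : R) ^+ N by rewrite exprn_ge0 // invr_ge0.
have LS N : L N <= L N.+1 /\ U N.+1 <= U N.
  have := xb N; rewrite ler_norml => /andP[h1 h2].
  rewrite /L /U /S !big_ord_recr /= !exprS; have := e0 N.
  by move: h1 h2; set z := _ ^+ N; set w := \sum_(i < N) _; split; lra.
have Lm m n : (m <= n)%N -> L m <= L n.
  move/subnK <-; elim: (n - m)%N => // d IH.
  by rewrite addSn; apply: (le_trans IH); case: (LS (d + m)%N).
have Um m n : (m <= n)%N -> U n <= U m.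
  move/subnK <-; elim: (n - m)%N => // d IH.
  by rewrite addSn; apply: (le_trans _ IH); case: (LS (d + m)%N).
have LU m n : L m <= U n.
  apply: (le_trans (Lm m (maxn m n) (leq_maxl _ _))).
  apply: (le_trans _ (Um n (maxn m n) (leq_maxr _ _))).
  by rewrite /L /U; have := e0 (maxn m n); set z := _ ^+ _; lra.
have Lsup : has_sup (range L).
  split; first by exists (L 0%N), 0%N.
  by exists (U 0%N) => _ [m _ <-].
exists (sup (range L)) => N.
have h1 : L N <= sup (range L) by apply: ub_le_sup; [case: Lsup | exists N].
have h2 : sup (range L) <= U N by apply: ge_sup; [case: Lsup | move=> _ [m _ <-]].
rewrite ler_norml; apply/andP; move: h1 h2; rewrite /L /U /S.
by set z := _ ^+ _; set w := \sum_(i < N) _; split; lra.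
Qed.

Lemma geometric_wsum a : (forall k, `|a k| <= 4^-1 ^+ k) -> exists s, wsum a s.
Proof.
move=> ab.
have re k : `|complex.Re (a k)| <= 4^-1 ^+ k.
  rewrite -lecR; apply: (le_trans (normc_ge_Re _)); apply: (le_trans (ab k)).
  by rewrite rmorphXn fmorphV rmorph_nat.
have im k : `|complex.Im (a k)| <= 4^-1 ^+ k.
  rewrite -lecR; have -> : complex.Im (a k) = - complex.Re (a k * 'i%C).
    by case: (a k) => x y /=; ring.
  rewrite normrN; apply: (le_trans (normc_ge_Re _)); rewrite normrM.
  have -> : `|'i%C : R[i]| = 1 by rewrite normc_def /= expr0n expr1n /= add0r sqrtr1.
  rewrite mulr1; apply: (le_trans (ab k)).
  by rewrite rmorphXn fmorphV rmorph_nat.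
have [x Hx] := real_geometric_sum re; have [y Hy] := real_geometric_sum im.
have q0 : (0 : C) <= 4^-1 by rewrite invr_ge0.
exists (x +i* y)%C, 4 => N; split.
  apply: (@le_trans _ _ (\sum_(k < N) 2^-1 ^+ k)).
    apply: ler_sum => k _; apply: (@le_trans _ _ (4^-1 ^+ k * 2 ^+ k)).
      by rewrite ler_wpM2r ?exprn_ge0.
    by rewrite -exprMn (_ : 4^-1 * 2 = 2^-1) //; field.
  by apply: (le_trans (sum_half_powers_le _ _)); rewrite ler_nat.
set S := \sum_(k < N) a k.
have reS : complex.Re S = \sum_(k < N) complex.Re (a k).
  by rewrite /S; elim/big_rec2: _ => // k u v _ <-; case: (a k) => ? ?; case: v.
have imS : complex.Im S = \sum_(k < N) complex.Im (a k).
  by rewrite /S; elim/big_rec2: _ => // k u v _ <-; case: (a k) => ? ?; case: v.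
have -> : ((x +i* y)%C - S) = (x - complex.Re S)%:C%C + 'i%C * (y - complex.Im S)%:C%C.
  by rewrite [LHS]complexE; case: S {reS imS}.
apply: (@le_trans _ _ ((4 * 4^-1 ^+ N) * 2 ^+ N)).
  rewrite ler_wpM2r ?exprn_ge0 //; apply: (le_trans (ler_normD _ _)).
  rewrite normrM.
  have -> : `|'i%C : R[i]| = 1 by rewrite normc_def /= expr0n expr1n /= add0r sqrtr1.
  rewrite mul1r (_ : 4 * 4^-1 ^+ N = 2 * 4^-1 ^+ N + 2 * 4^-1 ^+ N :> C); last by ring.
  have nr (r : R) : `|r%:C%C| = `|r|%:C%C :> C.
    by rewrite normc_def /= expr0n addr0 sqrtr_sqr.
  have E4 : (2 * 4^-1 ^+ N : C) = (2 * 4^-1 ^+ N : R)%:C%C.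
    by rewrite rmorphM rmorphXn fmorphV !rmorph_nat.
  by rewrite !nr E4 lerD // lecR ?reS ?imS.
rewrite -mulrA -exprMn (_ : 4^-1 * 2 = 2^-1); last by field.
by rewrite ler_piMr // exprn_ile1 ?invr_ge0 // invf_le1 ?ler1n.
Qed.

End ComplexWSum.

Section WSumLimit.
(* These properties of [R[i]] are kept as hypotheses on an abstract field: the topology
   of matrices is inferred from it. *)
Variable K : numFieldType.
Hypothesis pow2_dominates : forall c e : K, 0 <= c -> 0 < e ->
  exists N, forall m, (N <= m)%N -> c <= e * 2 ^+ m.

Lemma wsum_cvg a (s : K) : wsum a s -> series a @ \oo --> s.
Proof.
move=> [c Hc]; apply/cvgrPdist_le => e e0.
have c0 : 0 <= c by have [+ _] := Hc 0%N; rewrite big_ord0.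
have [N HN] := pow2_dominates c0 e0.
exists N => // m /= Nm; rewrite seriesEord.
have [h1 h2] := Hc m.
rewrite -(ler_pM2r (_ : 0 < 2 ^+ m)) ?exprn_gt0 //.
by apply: (le_trans h2); apply: HN.
Qed.

Lemma wsum_unique a (s t : K) : wsum a s -> wsum a t -> s = t.
Proof.
move=> /wsum_cvg h1 /wsum_cvg h2.
by apply: (cvg_unique _ h1 h2); apply: norm_hausdorff.
Qed.

End WSumLimit.

(** * Functions with an expansion in homogeneous polynomials *)

Section NearZero.
Variables (K : numFieldType) (n : nat).

Lemma near0W (P : 'M[K]_n -> Prop) : (forall u, P u) -> \forall u \near (0 : 'M[K]_n), P u.
Proof. move=> h; exact: (@filterE _ (nbhs (0 : 'M[K]_n)) (nbhs_filter _) P h). Qed.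

Lemma near0S (P Q : 'M[K]_n -> Prop) : (forall u, P u -> Q u) ->
  (\forall u \near (0 : 'M[K]_n), P u) -> \forall u \near (0 : 'M[K]_n), Q u.
Proof. move=> h; exact: (@filterS _ (nbhs (0 : 'M[K]_n)) (nbhs_filter _) P Q h). Qed.

Lemma near0S2 (P Q S : 'M[K]_n -> Prop) : (forall u, P u -> Q u -> S u) ->
  (\forall u \near (0 : 'M[K]_n), P u) -> (\forall u \near (0 : 'M[K]_n), Q u) ->
  \forall u \near (0 : 'M[K]_n), S u.
Proof. move=> h; exact: (@filterS2 _ (nbhs (0 : 'M[K]_n)) (nbhs_filter _) P Q S h). Qed.

Lemma near0_ball (P : 'M[K]_n -> Prop) : (\forall u \near (0 : 'M[K]_n), P u) <->
  exists2 e : K, 0 < e & forall u : 'M[K]_n, (forall i j, `|u i j| < e) -> P u.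
Proof.
split.
  move=> /nbhs_ballP [e /= e0 H]; exists e => // u ue; apply: H; split=> // i j.
  rewrite mxE -ball_normE /ball_ /= sub0r normrN.
  exact: ue.
move=> [e e0 H]; apply/nbhs_ballP; exists e => // u /= ue; apply: H => i j.
have := ue.2 i j; rewrite mxE -ball_normE /ball_ /= sub0r normrN.
by [].
Qed.

End NearZero.

Section HasExpansion.
Variables (K : numFieldType) (n : nat).
Implicit Types (f g : 'M[K]_n -> K) (p q r : glpoly K n).

(** The term [q] of degree [d] may be zero: then the order of [f] is larger than [d].  This
    makes the predicate additive in [q] for fixed [d], which is what determinants need. *)
Definition has_exp f (d : nat) q : Prop :=
  exists P : nat -> glpoly K n,
    [/\ forall k, P k \is k.-homog, forall k, (k < d)%N -> P k = 0, P d = q &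
        \forall u \near (0 : 'M[K]_n), wsum (fun k => gleval (P k) u) (f u)].

Lemma has_exp_near f g d q :
  (\forall u \near (0 : 'M[K]_n), f u = g u) -> has_exp f d q -> has_exp g d q.
Proof.
move=> fg [P [P1 P2 P3 P4]]; exists P; split=> //.
by apply: near0S2 fg P4 => u ->.
Qed.

Lemma has_exp_ext f g d q : f =1 g -> has_exp f d q -> has_exp g d q.
Proof. by move=> fg; apply: has_exp_near; apply: near0W. Qed.

Lemma gleval0 u : gleval (0 : glpoly K n) u = 0. Proof. exact: rmorph0. Qed.
Lemma glevalD p q u : gleval (p + q) u = gleval p u + gleval q u.
Proof. exact: rmorphD. Qed.
Lemma glevalM p q u : gleval (p * q) u = gleval p u * gleval q u.
Proof. exact: rmorphM. Qed.
Lemma gleval_sum (I : Type) (s : seq I) (P : pred I) (F : I -> glpoly K n) u :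
  gleval (\sum_(i <- s | P i) F i) u = \sum_(i <- s | P i) gleval (F i) u.
Proof. exact: rmorph_sum. Qed.

Lemma has_exp_const (c : K) : has_exp (fun=> c) 0 c%:MP.
Proof.
exists (fun k => if k == 0%N then c%:MP else 0); split=> //.
- case=> [|k] /=; last exact: dhomog0.
  by rewrite -[c%:MP]mulr1 mul_mpolyC dhomogZ ?dhomog1.
- apply: near0W => u; apply: wsum_ext (wsum_const c) => k.
  by case: eqP => _; rewrite ?gleval0 // /gleval mevalC.
Qed.

Lemma has_exp_add f g d q r : has_exp f d q -> has_exp g d r ->
  has_exp (fun u => f u + g u) d (q + r).
Proof.
move=> [P [P1 P2 P3 P4]] [Q [Q1 Q2 Q3 Q4]].
exists (fun k => P k + Q k); split=> [k|k kd||].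
- by rewrite dhomogD.
- by rewrite P2 // Q2 // addr0.
- by rewrite P3 Q3.
apply: near0S2 P4 Q4 => u Pu Qu.
by apply: wsum_ext (wsum_add Pu Qu) => k; rewrite glevalD.
Qed.

Lemma has_exp_mul f g d e q r : has_exp f d q -> has_exp g e r ->
  has_exp (fun u => f u * g u) (d + e) (q * r).
Proof.
move=> [P [P1 P2 P3 P4]] [Q [Q1 Q2 Q3 Q4]].
have low_term k j : (k <= d + e)%N -> (j <= k)%N -> (j, k) != (d, (d + e)%N) ->
    P j * Q (k - j)%N = 0.
  move=> kde jk ne; have [jd|dj] := ltnP j d; first by rewrite P2 ?mul0r.
  have [kje|ekj] := ltnP (k - j) e; first by rewrite Q2 ?mulr0.
  by case/eqP: ne; congr pair; lia.
exists (cauchy_prod P Q); split=> [k|k kd||].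
- apply: rpred_sum => j _; have jk : (j <= k)%N by rewrite -ltnS.
  by have := dhomogM (P1 j) (Q1 (k - j)%N); rewrite subnKC.
- rewrite /cauchy_prod big1 // => j _; apply: low_term; rewrite -1?ltnS //.
    by rewrite ltnW.
  by apply/eqP => -[_ kE]; rewrite kE ltnn in kd.
- rewrite /cauchy_prod (bigD1 (inord d)) //= inordK ?ltnS ?leq_addr //.
  rewrite addKn P3 Q3 big1 ?addr0 // => j jd; apply: low_term; rewrite -1?ltnS //.
  apply: contraNneq jd => -[jE]; apply/eqP/val_inj.
  by rewrite /= inordK ?jE // ltnS leq_addr.
apply: near0S2 P4 Q4 => u Pu Qu.
apply: wsum_ext (wsum_mul Pu Qu) => k; rewrite /cauchy_prod gleval_sum.
by apply: eq_bigr => j _; rewrite glevalM.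
Qed.

Lemma has_exp_weaken f d e q : (d < e)%N -> has_exp f e q -> has_exp f d 0.
Proof.
move=> de [P [P1 P2 P3 P4]]; exists P; split=> // [k kd|]; last exact: P2.
by rewrite P2 // (ltn_trans kd).
Qed.

Lemma has_exp_scale f d q (c : K) : has_exp f d q ->
  has_exp (fun u => c * f u) d (c%:MP * q).
Proof. by move/(has_exp_mul (has_exp_const c)); rewrite add0n. Qed.

Lemma has_exp_zero d : has_exp (fun=> 0) d 0.
Proof.
exists (fun=> 0); split=> // [k|]; first exact: dhomog0.
apply: near0W => u; apply: wsum_ext (wsum_const 0) => k.
by rewrite gleval0 if_same.
Qed.

Lemma has_exp_sum (I : Type) (s : seq I) (P : pred I) (F : I -> 'M[K]_n -> K) d
    (Q : I -> glpoly K n) :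
  (forall i, P i -> has_exp (F i) d (Q i)) ->
  has_exp (fun u => \sum_(i <- s | P i) F i u) d (\sum_(i <- s | P i) Q i).
Proof.
move=> FQ; elim: s => [|i s IH].
  rewrite big_nil; apply: has_exp_ext (has_exp_zero d) => u.
  by rewrite big_nil.
rewrite big_cons; case Pi : (P i).
  by apply: has_exp_ext (has_exp_add (FQ i Pi) IH) => u; rewrite big_cons Pi.
by apply: has_exp_ext IH => u; rewrite big_cons Pi.
Qed.

Lemma has_exp_prod (I : Type) (s : seq I) (F : I -> 'M[K]_n -> K) (d : I -> nat)
    (Q : I -> glpoly K n) :
  (forall i, has_exp (F i) (d i) (Q i)) ->
  has_exp (fun u => \prod_(i <- s) F i u) (\sum_(i <- s) d i) (\prod_(i <- s) Q i).
Proof.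
move=> FQ; elim: s => [|i s IH].
  rewrite !big_nil; apply: has_exp_ext (has_exp_const 1) => u.
  by rewrite big_nil.
rewrite !big_cons.
by apply: has_exp_ext (has_exp_mul (FQ i) IH) => u; rewrite big_cons.
Qed.

(** Column [j] vanishes to order [d j], so each of the Leibniz products vanishes to the
    same order [\sum_j d j]: the leading terms assemble into a determinant. *)
Lemma has_exp_det m (F : 'I_m -> 'I_m -> 'M[K]_n -> K) (d : 'I_m -> nat)
    (Q : 'M[glpoly K n]_m) :
  (forall i j, has_exp (F i j) (d j) (Q i j)) ->
  has_exp (fun u => \det (\matrix_(i, j) F i j u)) (\sum_j d j) (\det Q).
Proof.
move=> FQ; rewrite /determinant.
apply: (@has_exp_ext (fun u => \sum_(s : 'S_m) ((-1) ^+ s * \prod_i F i (s i) u))).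
  by move=> u; apply: eq_bigr => s _; congr (_ * _); apply: eq_bigr => i _; rewrite mxE.
apply: has_exp_sum => s _.
have -> : ((-1) ^+ s : glpoly K n) = ((-1) ^+ s)%:MP.
  by rewrite rmorphXn rmorphN rmorph1.
apply: has_exp_scale.
have -> : (\sum_j d j = \sum_i d (s i))%N by rewrite (reindex_inj (@perm_inj _ s)).
exact: has_exp_prod.
Qed.

Lemma has_exp_mx_mul m1 m2 m3 (F : 'I_m1 -> 'I_m2 -> 'M[K]_n -> K)
    (G : 'I_m2 -> 'I_m3 -> 'M[K]_n -> K) d e (P : 'M_(m1, m2)) (Q : 'M_(m2, m3)) :
  (forall i j, has_exp (F i j) d (P i j)) ->
  (forall i j, has_exp (G i j) e (Q i j)) ->
  forall i j, has_exp (fun u => \sum_k F i k u * G k j u) (d + e) ((P *m Q) i j).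
Proof.
move=> FP GQ i j; rewrite mxE; apply: has_exp_sum => k _; exact: has_exp_mul.
Qed.

Lemma has_exp_mx_pow (A : 'M[K]_n -> 'M[K]_n) (L : 'M[glpoly K n]_n) :
  (forall i j, has_exp (fun u => A u i j) 1 (L i j)) ->
  forall k i j, has_exp (fun u => (A u ^+ k) i j) k ((L ^+ k) i j).
Proof.
move=> AL; elim=> [|k IH] i j.
  have E1 (S : comNzRingType) : (1 : 'M[S]_n) i j = (i == j)%:R.
    by rewrite -[1]/(1%:M) mxE.
  have -> : (L ^+ 0) i j = ((i == j)%:R : K)%:MP by rewrite expr0 E1 rmorph_nat.
  by apply: has_exp_ext (has_exp_const _) => u; rewrite expr0 E1.
rewrite [L ^+ _]exprS; apply: has_exp_ext (has_exp_mx_mul AL IH i j) => u.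
by rewrite exprS mxE.
Qed.

End HasExpansion.

(** * Taylor expansions and the matrix exponential *)

Lemma wsum_sum (K : numFieldType) (I : Type) (r : seq I) (a : I -> nat -> K) (s : I -> K) :
  (forall i, wsum (a i) (s i)) ->
  wsum (fun k => \sum_(i <- r) a i k) (\sum_(i <- r) s i).
Proof.
move=> as_; elim: r => [|i r IH].
  rewrite big_nil; apply: wsum_ext (wsum_const 0) => k.
  by rewrite big_nil if_same.
rewrite big_cons; apply: wsum_ext (wsum_add (as_ i) IH) => k.
by rewrite big_cons.
Qed.

Section Taylor.
Variable K : numFieldType.
Hypothesis pow2_dominates : forall c e : K, 0 <= c -> 0 < e ->
  exists N, forall m, (N <= m)%N -> c <= e * 2 ^+ m.
Hypothesis geometric_sums : forall a : nat -> K,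
  (forall k, `|a k| <= 4^-1 ^+ k) -> exists s, wsum a s.

(** Otherwise let [a m] be the first nonzero coefficient.  At [t = t0 / 2 ^ i] the later
    terms are of the order of [2 ^ - (i * m.+1)], too small to cancel the term of
    degree [m]. *)
Lemma power_series_eq0 (a : nat -> K) (e : K) : 0 < e ->
  (forall t, `|t| < e -> series (fun k => a k * t ^+ k) @ \oo --> (0 : K)) ->
  forall k, a k = 0.
Proof.
move=> e0 acvg; pose t0 := e / 2.
have t00 : 0 < t0 by rewrite divr_gt0.
have t0ge := ltW t00.
have t0e : t0 < e by rewrite /t0 ltr_pdivrMr // mulr_natr mulr2n ltrDl.
have small t (d : K) : 0 <= t -> t <= t0 -> 0 < d -> exists N, forall m, (N <= m)%N ->
    `|\sum_(k < m) a k * t ^+ k| <= d.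
  move=> t_ge0 tt0 d0; have te : `|t| < e by rewrite ger0_norm ?(le_lt_trans tt0).
  have /cvgrPdist_le/(_ d d0) [N _ HN] := acvg t te.
  by exists N => m Nm; have := HN m Nm; rewrite /= seriesEord sub0r normrN.
have [M M0 HM] : exists2 M, 0 <= M & forall k, `|a k| * t0 ^+ k <= M.
  have [//|N HN] := @small t0 1 (ltW t00) (lexx _).
  have term0 k : 0 <= `|a k| * t0 ^+ k by rewrite mulr_ge0 ?exprn_ge0.
  exists (2 + \sum_(k < N) `|a k| * t0 ^+ k); first by rewrite addr_ge0 ?sumr_ge0.
  move=> k; have [kN|Nk] := ltnP k N.
    rewrite (bigD1 (Ordinal kN)) //= addrCA lerDl addr_ge0 ?sumr_ge0 //.
  apply: (@le_trans _ _ 2); last by rewrite lerDl sumr_ge0.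
  have := lerD (HN k.+1 (leqW Nk)) (HN k Nk); rewrite big_ord_recr /=.
  set S := \sum_(j < k) _ => H; rewrite (_ : 2 = 1 + 1 :> K) //; apply: le_trans H.
  rewrite -{1}(ger0_norm t0ge) -normrX -normrM.
  move: (a k * t0 ^+ k) => z; have -> : `|z| = `|S + z - S| by congr (`|_|); ring.
  exact: ler_normB.
move=> m; elim/ltn_ind: m => m IH.
apply/eqP; apply: contraT => am0.
pose c := `|a m| * t0 ^+ m.
have c0 : 0 < c by rewrite mulr_gt0 ?normr_gt0 ?exprn_gt0.
have B0 : 0 < 1 + 2 * M by rewrite ltr_wpDr ?mulr_ge0.
have [N HN] := @pow2_dominates (2 * (1 + 2 * M)) c (mulr_ge0 (ler0n _ _) (ltW B0)) c0.
have {HN} := HN N.+1 (leqnSn N).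
pose r : K := 2^-1 ^+ N.+1.
have r0 : 0 < r by rewrite exprn_gt0 ?invr_gt0.
have rge := ltW r0.
have rh : r <= 2^-1.
  by rewrite /r exprS ler_piMr ?invr_ge0 // exprn_ile1 ?invr_ge0 ?invf_le1 ?ler1n.
have r1 : r <= 1 by apply: (le_trans rh); rewrite invf_le1 ?ler1n.
have r2 : r * 2 ^+ N.+1 = 1 by rewrite /r -exprMn mulVf ?pnatr_eq0 // expr1n.
clearbody r.
have s0 : 0 <= t0 * r by rewrite mulr_ge0.
have st0 : t0 * r <= t0 by rewrite ler_piMr.
have [//|n Hn] := @small _ (r ^+ m.+1) s0 st0; first by rewrite exprn_gt0.
have := Hn (m.+1 + n)%N (leq_addl _ _).
rewrite big_split_ord big_ord_recr /= big1 ?add0r => [Hs|k _]; last by rewrite IH ?mul0r.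
have tail : `|\sum_(i < n) a (m.+1 + i)%N * (t0 * r) ^+ (m.+1 + i)| <= r ^+ m.+1 * (2 * M).
  apply: (le_trans (ler_norm_sum _ _ _)).
  apply: (@le_trans _ _ (\sum_(i < n) (M * r ^+ m.+1) * 2^-1 ^+ i)).
    apply: ler_sum => i _.
    rewrite normrM normrX (ger0_norm s0) exprMn mulrA -[leRHS]mulrA.
    apply: ler_pM; rewrite ?mulr_ge0 ?exprn_ge0 ?invr_ge0 //.
    by rewrite exprD ler_wpM2l ?exprn_ge0 ?lerXn2r ?nnegrE ?invr_ge0.
  rewrite -mulr_sumr.
  have := sum_half_powers_le K n; set h := \sum_(i < n) _ => hh.
  have : (M * r ^+ m.+1) * h <= (M * r ^+ m.+1) * 2 by rewrite ler_wpM2l ?mulr_ge0 ?exprn_ge0.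
  by move=> H; rewrite (_ : r ^+ m.+1 * (2 * M) = (M * r ^+ m.+1) * 2) //; ring.
have main : c * r ^+ m <= r ^+ m.+1 * (1 + 2 * M).
  have -> : c * r ^+ m = `|a m * (t0 * r) ^+ m|.
    by rewrite exprMn !normrM !normrX (gtr0_norm t00) (gtr0_norm r0) /c mulrA.
  rewrite mulrDr mulr1; apply: le_trans (lerD Hs tail).
  move: (\sum_(i < n) _) => T; have {1}<- : (a m * (t0 * r) ^+ m + T) - T =
    a m * (t0 * r) ^+ m by ring.
  exact: ler_normB.
have {main} : c <= r * (1 + 2 * M).
  by move: main; rewrite exprS (mulrAC r) ler_pM2r ?exprn_gt0.
move=> H1 H2; have {H1} : c * 2 ^+ N.+1 <= 1 + 2 * M.
  apply: (le_trans (ler_wpM2r _ H1)); first by rewrite exprn_ge0.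
  by rewrite mulrAC r2 mul1r.
move=> H1; have := le_trans H2 H1.
by rewrite ger_pMl // lern1.
Qed.

Section Matrices.
Variable n : nat.

(** The chart [u = x - y] splits the diagonal of [u] evenly between [x] and [- y]. *)
Definition gst_upper_coef (i j : 'I_n) : K :=
  if (i < j)%N then 1 else if i == j then 2^-1 else 0.

Definition gst_upper (u : 'M[K]_n) : 'M[K]_n := \matrix_(i, j) (gst_upper_coef i j * u i j).

Lemma gst_upperP (u : 'M[K]_n) : in_gst (gst_upper u) (gst_upper u - u).
Proof.
split.
- apply/is_trig_mxP => i j ij; rewrite !mxE /gst_upper_coef ltnNge (ltnW ij) /=.
  by case: eqP => [E|]; [rewrite E ltnn in ij | rewrite mul0r].
- by apply/is_trig_mxP => i j ij; rewrite !mxE /gst_upper_coef ij mul1r subrr.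
- by move=> i; rewrite !mxE /gst_upper_coef ltnn eqxx; field.
Qed.

Lemma gst_upper_unique (x y : 'M[K]_n) : in_gst x y ->
  x = gst_upper (x - y) /\ y = gst_upper (x - y) - (x - y).
Proof.
move=> [/is_trig_mxP xt /is_trig_mxP yt xy].
suff E : x = gst_upper (x - y) by split=> //; rewrite -E opprB addrCA subrr addr0.
apply/matrixP => i j; rewrite !mxE /gst_upper_coef.
case: (ltngtP i j) => ij; first by rewrite yt // subr0 mul1r.
  by have := xt j i ij; rewrite mxE => ->; case: eqP ij => [->|]; rewrite ?ltnn // mul0r.
have -> : i = j by apply: val_inj.
by rewrite eqxx xy; field.
Qed.

Lemma gleval_homog k (p : glpoly K n) (t : K) (u : 'M[K]_n) : p \is k.-homog ->
  gleval p (t *: u) = gleval p u * t ^+ k.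
Proof.
move=> /dhomogP hp; rewrite /gleval !mevalE mulr_suml big_seq [RHS]big_seq.
apply: eq_bigr => m mp; rewrite -mulrA; congr (_ * _).
have <- := hp m mp; rewrite /= mdegE (big_morph (fun k => t ^+ k) (exprD t) (expr0 t)).
rewrite -big_split /=; apply: eq_bigr => i _.
by rewrite linearZ /= mxE exprMn mulrC.
Qed.

Lemma glpoly_eq0 (p : glpoly K n) : (forall u, gleval p u = 0) -> p = 0.
Proof.
move=> pz; apply/eqP; apply: contraT => /mpoly_nonvanishing [v _].
have <- : gleval p (vec_mx (\row_k v k)) = p.@[v].
  by rewrite /gleval vec_mxK; apply: meval_eq => k; rewrite mxE.
by rewrite pz eqxx.
Qed.

(** On the line through 0 and [u], a Taylor expansion becomes a power series in the
    parameter of the line. *)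
Lemma taylor_unique (f : 'M[K]_n -> 'M[K]_n -> K) P Q :
  taylor_expansion f P -> taylor_expansion f Q -> P =1 Q.
Proof.
move=> [Ph Pf] [Qh Qf] k; apply/eqP; rewrite -subr_eq0; apply/eqP.
apply: glpoly_eq0 => u; move: k.
have /near0_ball[e e0 He] : \forall u \near (0 : 'M[K]_n),
    series (fun k => gleval (P k - Q k) u) @ \oo --> (0 : K).
  apply: near0S2 Pf Qf => v Pv Qv.
  have [g gv] : in_gst (gst_upper v) (gst_upper v - v) /\ gst_upper v - (gst_upper v - v) = v.
    by split; [exact: gst_upperP | rewrite opprB addrC subrK].
  have E : series (fun k => gleval (P k - Q k) v) =
      (fun m => series (fun k => gleval (P k) v) m - series (fun k => gleval (Q k) v) m).
    apply/funext => m; rewrite /series /= -sumrB.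
    by apply: eq_bigr => k _; rewrite /gleval rmorphB.
  rewrite E -(subrr (f (expmx (gst_upper v)) (expmx (gst_upper v - v)))).
  exact: cvgB (Pv _ _ g gv) (Qv _ _ g gv).
pose b := 1 + \sum_i \sum_j `|u i j|.
have b0 : 0 < b by rewrite ltr_pwDl // sumr_ge0 // => i _; rewrite sumr_ge0.
have ub i j : `|u i j| <= b.
  apply: (@le_trans _ _ (\sum_i \sum_j `|u i j|)); last by rewrite lerDr.
  rewrite (bigD1 i) //= (bigD1 j) //= -addrA lerDl addr_ge0 ?sumr_ge0 // => k _.
  by rewrite sumr_ge0.
apply: (@power_series_eq0 _ (e / b)); first by rewrite divr_gt0.
move=> t te; have -> : (fun k => gleval (P k - Q k) u * t ^+ k) =
   (fun k => gleval (P k - Q k) (t *: u)).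
  apply/funext => k; rewrite (gleval_homog (k := k)) //.
  by apply: rpredB; [exact: Ph | exact: Qh].
apply: He => i j; rewrite mxE normrM.
have [->|t0] := eqVneq t 0; first by rewrite normr0 mul0r.
apply: (@le_lt_trans _ _ (`|t| * b)); first by rewrite ler_wpM2l.
by rewrite -ltr_pdivlMr.
Qed.

Lemma low_eq (f : 'M[K]_n -> 'M[K]_n -> K) d q :
  has_exp (fun u => f (expmx (gst_upper u)) (expmx (gst_upper u - u))) d q ->
  q != 0 -> low f = q.
Proof.
move=> [P [P1 P2 P3 P4]] q0.
have tP : taylor_expansion f P.
  split=> //; apply: near0S P4 => u Pu x y g xyu.
  have [ex ey] := gst_upper_unique g; rewrite xyu in ex ey; rewrite ex ey.
  exact: (wsum_cvg pow2_dominates Pu).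
apply: xget_unique; first by exists P, d; split=> //; rewrite P3.
move=> r [P' [d' [T' Z' N' ->]]]; have PP' := taylor_unique tP T'.
case: (ltngtP d d') => dd'; last by rewrite -dd' -PP'.
  by move: q0; rewrite -P3 PP' Z' ?eqxx.
by move: N'; rewrite -PP' P2 ?eqxx.
Qed.

(** The entries of the powers of a matrix with entries at most [1 / (4 n)] decay like
    [4 ^ - k]. *)
Lemma mx_pow_geometric (x : 'M[K]_n) : (forall i j, `|x i j| <= (4 * n%:R)^-1) ->
  forall k i j, `|(x ^+ k) i j| <= 4^-1 ^+ k.
Proof.
move=> xb; elim=> [|k IH] i j.
  have -> : (x ^+ 0) i j = (i == j)%:R by rewrite expr0 -[1]/(1%:M) mxE.
  by rewrite normr_nat lern1 leq_b1.
have n0 : n%:R != 0 :> K by rewrite pnatr_eq0; case: (n) i => [[]|].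
rewrite exprS mxE; apply: (le_trans (ler_norm_sum _ _ _)).
apply: (@le_trans _ _ (\sum_(l < n) (4 * n%:R)^-1 * 4^-1 ^+ k)).
  by apply: ler_sum => l _; rewrite normrM ler_pM.
rewrite sumr_const card_ord -[_ *+ n]mulr_natr exprS.
by rewrite (_ : _ * n%:R = 4^-1 * 4^-1 ^+ k) //; field.
Qed.

Lemma expmx_wsum (x : 'M[K]_n) : (forall i j, `|x i j| <= (4 * n%:R)^-1) ->
  forall i j, wsum (fun k => (k`!%:R)^-1 * (x ^+ k) i j) (expmx x i j).
Proof.
move=> xb.
have ex ij : exists s, wsum (fun k => (k`!%:R)^-1 * (x ^+ k) ij.1 ij.2) s.
  apply: geometric_sums => k; rewrite normrM -[leRHS]mul1r; apply: ler_pM => //.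
    by rewrite normfV normr_nat invf_le1 ?ler1n ?ltr0n fact_gt0.
  exact: mx_pow_geometric.
have /choice[s Hs] := ex.
pose S : 'M[K]_n := \matrix_(i, j) s (i, j).
suff E : expmx x = S by move=> i j; rewrite E mxE; exact: (Hs (i, j)).
apply: cvg_lim; first exact: norm_hausdorff.
apply/cvgrPdist_lt => e e0.
have near_entry ij : \forall N \near \oo,
    `|s ij - series (fun k => (k`!%:R)^-1 * (x ^+ k) ij.1 ij.2) N| < e.
  by have /cvgrPdist_lt/(_ e e0) := wsum_cvg pow2_dominates (Hs ij).
have FN : Filter (\oo : set_system nat) by exact _.
have := filter_forall FN near_entry; apply: filterS => N HN.
rewrite -[X in X < _]normrN opprB.
have : ball S e (series (fun k => (k`!%:R)^-1 *: x ^+ k) N).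
  split=> // i j; rewrite -ball_normE /ball_ /=.
  have := HN (i, j); rewrite /S !seriesEord /= mxE summxE.
  by under [in X in _ -> X]eq_bigr do rewrite mxE.
by rewrite -ball_normE /ball_ /= distrC.
Qed.

(** The Cauchy product of the two exponential series is, in positive degree, a multiple of
    the binomial expansion of [(x - x) ^ k]. *)
Lemma expmxN (x : 'M[K]_n) : (forall i j, `|x i j| <= (4 * n%:R)^-1) ->
  expmx x *m expmx (- x) = 1%:M.
Proof.
move=> xb; apply/matrixP => i j.
have xbN i' j' : `|(- x) i' j'| <= (4 * n%:R)^-1 by rewrite mxE normrN.
pose a k := cauchy_prod (fun k => (k`!%:R)^-1 *: x ^+ k)
                        (fun k => (k`!%:R)^-1 *: (- x) ^+ k) k.
have aE k : a k = if k == 0%N then 1 else 0.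
  case: k => [|k]; first by rewrite /a /cauchy_prod big_ord1 !expr0 fact0 invr1 !scale1r mulr1.
  have : (x - x) ^+ k.+1 = (k.+1)`!%:R *: a k.+1.
    rewrite addrC exprDn_comm; last by rewrite /GRing.comm mulNr mulrN.
    rewrite /a /cauchy_prod scaler_sumr; apply: eq_bigr => l _.
    have lk : (l <= k.+1)%N by rewrite -ltnS.
    have mE (A B : 'M[K]_n) : A * B = A *m B by [].
    rewrite [X in _ *: X]mE -scalemxAl -scalemxAr !scalerA.
    rewrite -scaler_nat; congr (_ *: _); last by apply: commrX; apply/commr_sym/commrX/commrN.
    rewrite -(bin_fact lk) natrM natrM; field.
    by rewrite !pnatr_eq0 -!lt0n !fact_gt0.
  rewrite subrr expr0n /= => /esym/eqP; rewrite scaler_eq0 pnatr_eq0.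
  by rewrite eqn0Ngt fact_gt0 => /eqP.
have prod_sum : wsum (fun k => (a k) i j) ((expmx x *m expmx (- x)) i j).
  rewrite mxE.
  have := wsum_sum (index_enum 'I_n) (fun l => wsum_mul (expmx_wsum xb i l) (expmx_wsum xbN l j)).
  apply: wsum_ext => k; rewrite /a /cauchy_prod summxE exchange_big; apply: eq_bigr => l _.
  by rewrite -[in RHS]/(_ *m _) mxE; apply: eq_bigr => h _; rewrite !mxE.
apply: (wsum_unique pow2_dominates prod_sum).
rewrite mxE; apply: wsum_ext (wsum_const _) => k; rewrite aE.
by case: eqP; rewrite ?mxE.
Qed.

Lemma expmx_trig (x : 'M[K]_n) : (forall i j, `|x i j| <= (4 * n%:R)^-1) ->
  is_trig_mx x^T -> is_trig_mx (expmx x)^T.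
Proof.
move=> xb /is_trig_mxP xt; apply/is_trig_mxP => i j ij; rewrite mxE.
apply: (wsum_unique pow2_dominates (expmx_wsum xb j i)).
apply: wsum_ext (wsum_const 0) => k; rewrite if_same.
suff -> : (x ^+ k) j i = 0 by rewrite mulr0.
elim: k i j ij => [|k IH] i j ij.
  by rewrite expr0 -[1]/(1%:M) mxE -val_eqE /= gtn_eqF.
rewrite exprS mxE big1 // => l _.
have [li|il] := leqP l i; last by rewrite IH ?mulr0.
by have := xt l j (leq_ltn_trans li ij); rewrite mxE => ->; rewrite mul0r.
Qed.

(** The matrices [x], [- x], [y], [- y] of the chart are all of this kind.  The polynomial
    form [L] gives the terms of the exponential series, and the bound on the coefficients
    makes [A u] small as soon as [u] is. *)
Definition scaled_entries (A : 'M[K]_n -> 'M[K]_n) (L : 'M[glpoly K n]_n) : Prop :=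
  exists2 c : 'M[K]_n, (forall i j, `|c i j| <= 1) &
    forall i j, L i j = (c i j)%:MP * coordmx K n i j /\
                forall u, A u i j = c i j * u i j.

Lemma gleval_coordmx i j (u : 'M[K]_n) : gleval (coordmx K n i j) u = u i j.
Proof. by rewrite /gleval mxE mevalXU mxvecE. Qed.

Lemma gleval_mx_pow (A : 'M[K]_n -> 'M[K]_n) (L : 'M[glpoly K n]_n) :
  scaled_entries A L ->
  forall k i j u, gleval ((L ^+ k) i j) u = (A u ^+ k) i j.
Proof.
move=> [c _ AL]; elim=> [|k IH] i j u.
  by rewrite !expr0 -[1]/(1%:M) -[1 in RHS]/(1%:M) !mxE /gleval rmorph_nat.
rewrite !exprS !mxE gleval_sum; apply: eq_bigr => l _.
have [-> ->] := AL i l.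
by rewrite !glevalM IH gleval_coordmx /gleval mevalC.
Qed.

Lemma homog_mx_pow (A : 'M[K]_n -> 'M[K]_n) (L : 'M[glpoly K n]_n) :
  scaled_entries A L -> forall k i j, (L ^+ k) i j \is k.-homog.
Proof.
move=> [c _ AL]; elim=> [|k IH] i j.
  rewrite expr0 -[1]/(1%:M) mxE; case: eqP => _; first exact: dhomog1.
  exact: dhomog0.
rewrite exprS mxE; apply: rpred_sum => l _; rewrite -add1n; apply: dhomogM => //.
have [-> _] := AL i l.
by rewrite mul_mpolyC dhomogZ // mxE dhomogX /= mdeg1.
Qed.

Lemma near0_small : \forall u \near (0 : 'M[K]_n),
  forall i j : 'I_n, `|(u : 'M[K]_n) i j| <= (4 * n%:R)^-1.
Proof.
case: (posnP n) => [n0|n0].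
  by apply: near0W => u i; move: (ltn_ord i); rewrite {2}n0.
apply/near0_ball; exists (4 * n%:R)^-1; first by rewrite invr_gt0 mulr_gt0 ?ltr0n.
by move=> u ub i j; rewrite ltW.
Qed.

Lemma scaled_entries_small A L : scaled_entries A L ->
  forall u : 'M[K]_n, (forall i j, `|u i j| <= (4 * n%:R)^-1) ->
  forall i j, `|A u i j| <= (4 * n%:R)^-1.
Proof.
move=> [c c1 AL] u ub i j; have [_ ->] := AL i j.
by rewrite normrM; apply: le_trans (ub i j); rewrite ler_piMl.
Qed.

Lemma has_exp_expmx A L : scaled_entries A L ->
  forall i j, has_exp (fun u => (expmx (A u) - 1%:M) i j) 1 (L i j).
Proof.
move=> AL i j.
exists (fun k => if k == 0%N then 0 else (k`!%:R^-1)%:MP * (L ^+ k) i j); split.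
- case=> [|k] /=; first exact: dhomog0.
  by rewrite mul_mpolyC dhomogZ // (homog_mx_pow AL).
- by case.
- by rewrite (_ : 1`! = 1%N) // invr1 mul1r expr1.
apply: near0S near0_small => u ub.
have := wsum_add (expmx_wsum (scaled_entries_small AL ub) i j) (wsum_const (- (i == j)%:R)).
rewrite !mxE; apply: wsum_ext => -[|k] /=.
  by rewrite gleval0 expr0 fact0 invr1 mul1r -[1]/(1%:M) mxE subrr.
by rewrite addr0 glevalM (gleval_mx_pow AL) /gleval mevalC.
Qed.

(** Put [a = exp A - 1] and [b = exp B - 1]; then [exp A * exp B - 1 = a * b + a + b], where
    [a * b] has order two. *)
Lemma has_exp_expmx_mul A B LA LB : scaled_entries A LA -> scaled_entries B LB ->
  forall i j, has_exp (fun u => (expmx (A u) *m expmx (B u) - 1%:M) i j) 1 ((LA + LB) i j).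
Proof.
move=> hA hB i j.
have H2 := has_exp_weaken (ltnSn 1) (has_exp_mx_mul (has_exp_expmx hA) (has_exp_expmx hB) i j).
have := has_exp_add H2 (has_exp_add (has_exp_expmx hA i j) (has_exp_expmx hB i j)).
rewrite add0r [(LA + LB) i j]mxE; apply: has_exp_ext => u.
set EA := expmx (A u); set EB := expmx (B u).
have -> : \sum_k (EA - 1%:M) i k * (EB - 1%:M) k j = ((EA - 1%:M) *m (EB - 1%:M)) i j.
  by rewrite mxE.
rewrite mulmxBl mulmxBr mul1mx mulmx1 !mxE; ring.
Qed.

Lemma gst_upper_coef_le1 i j : `|gst_upper_coef i j| <= 1.
Proof.
rewrite /gst_upper_coef; case: ifP => _; first by rewrite normr1.
case: ifP => _; last by rewrite normr0.
by rewrite normfV normr_nat invf_le1 ?ler1n.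
Qed.

Definition gst_upper_lin : 'M[glpoly K n]_n :=
  \matrix_(i, j) ((gst_upper_coef i j)%:MP * coordmx K n i j).

Lemma gst_upper_scaled : scaled_entries gst_upper gst_upper_lin.
Proof.
exists (\matrix_(i, j) gst_upper_coef i j) => i j; rewrite !mxE ?gst_upper_coef_le1 //.
by split=> // u; rewrite !mxE.
Qed.

Lemma gst_lower_scaled :
  scaled_entries (fun u => gst_upper u - u) (gst_upper_lin - coordmx K n).
Proof.
exists (\matrix_(i, j) (gst_upper_coef i j - 1)) => i j; rewrite !mxE; last first.
  by split=> [|u]; rewrite ?mxE ?rmorphB ?rmorph1; ring.
rewrite /gst_upper_coef; case: ifP => _; first by rewrite subrr normr0.
case: ifP => _; last by rewrite sub0r normrN1.
have -> : 2^-1 - 1 = - 2^-1 :> K by field.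
by rewrite normrN normfV normr_nat invf_le1 ?ler1n.
Qed.

Lemma scaled_entriesN A L : scaled_entries A L -> scaled_entries (fun u => - A u) (- L).
Proof.
move=> [c c1 AL]; exists (- c) => i j; first by rewrite mxE normrN.
have [LE AE] := AL i j; split=> [|u]; first by rewrite !mxE LE mxE rmorphN mulNr.
by rewrite !mxE AE mulNr.
Qed.

(** [X^-1 Y - 1 = - u + ...] and [X Y^-1 - 1 = u + ...], since [u = x - y]. *)
Lemma has_exp_dual_quotient i j :
  has_exp (fun u => (expmx (- gst_upper u) *m expmx (gst_upper u - u) - 1%:M) i j)
    1 ((- coordmx K n) i j).
Proof.
have := has_exp_expmx_mul (scaled_entriesN gst_upper_scaled) gst_lower_scaled i j.
by rewrite addrA addNr sub0r.
Qed.

Lemma has_exp_quotient i j :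
  has_exp (fun u => (expmx (gst_upper u) *m expmx (- (gst_upper u - u)) - 1%:M) i j)
    1 (coordmx K n i j).
Proof.
have := has_exp_expmx_mul gst_upper_scaled (scaled_entriesN gst_lower_scaled) i j.
by rewrite opprB addrCA subrr addr0.
Qed.

End Matrices.
End Taylor.

(** * Factorization of the trailing minors of the staircase matrix *)

Lemma ent_lt (T : nmodType) (m n : nat) (A : 'M[T]_(m, n)) a b (ha : (a < m)%N) (hb : (b < n)%N) :
  ent A a.+1 b.+1 = A (Ordinal ha) (Ordinal hb).
Proof.
rewrite /ent; case: pickP => [[c d] /= /andP[/eqP[Ec] /eqP[Ed]]|].
  by congr (A _ _); apply: val_inj.
by move/(_ (Ordinal ha, Ordinal hb)); rewrite /= !eqxx.
Qed.

Section NatMatrices.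
Variable R : comNzRingType.
Implicit Types g : nat -> nat -> R.

Local Notation natmx S g := (\matrix_(a < S, b < S) g (nat_of_ord a) (nat_of_ord b)).

Lemma natmx_mul S g g' :
  natmx S g *m natmx S g' = natmx S (fun a b => \sum_(c < S) g a c * g' c b).
Proof. by apply/matrixP => a b; rewrite !mxE; apply: eq_bigr => c _; rewrite !mxE. Qed.

Lemma det_natmx_upper S g :
  (forall a b, (b < a < S)%N -> g a b = 0) ->
  \det (natmx S g) = \prod_(a < S) g a a.
Proof.
move=> g0; rewrite -det_tr det_trig.
  by apply: eq_bigr => a _; rewrite !mxE.
by apply/is_trig_mxP => a b ab; rewrite !mxE g0 // ab ltn_ord.
Qed.

(** The sign does not depend on the matrix, so that one reordering of the columns can be
    used for a whole family of matrices. *)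
Lemma det_natmx_reindex S (h : nat -> nat) :
  (forall b, (b < S)%N -> (h b < S)%N) ->
  (forall b c, (b < S)%N -> (c < S)%N -> h b = h c -> b = c) ->
  exists e : bool, forall g,
    \det (natmx S g) = (-1) ^+ e * \det (natmx S (fun a b => g a (h b))).
Proof.
move=> hS hinj; pose h' (b : 'I_S) : 'I_S := Ordinal (hS b (ltn_ord b)).
have h'inj : injective h' by move=> b c [] /hinj E; apply: val_inj; apply: E.
exists (perm h'inj) => g.
have -> : natmx S (fun a b => g a (h b)) = col_perm (perm h'inj) (natmx S g).
  by apply/matrixP => a b; rewrite !mxE permE.
by rewrite col_permE det_mulmx det_perm odd_permV mulrCA -signr_addb addbb mulr1.
Qed.

Lemma det_natmx_ublock w v g :
  (forall a b, (w <= a < w + v)%N -> (b < w)%N -> g a b = 0) ->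
  (forall a b, (w <= b < a)%N -> (a < w + v)%N -> g a b = 0) ->
  \det (natmx (w + v) g) = \det (natmx w g) * \prod_(a < v) g (w + a)%N (w + a)%N.
Proof.
move=> g0 g1.
have -> : natmx (w + v) g =
    block_mx (natmx w g) (\matrix_(a < w, b < v) g a (w + b)%N)
             0 (natmx v (fun a b => g (w + a)%N (w + b)%N)).
  apply/matrixP => a b; rewrite mxE -[a]splitK -[b]splitK.
  case: (split a) => a'; case: (split b) => b';
    rewrite /= ?block_mxEul ?block_mxEur ?block_mxEdl ?block_mxEdr !mxE //=.
  by rewrite g0 // leq_addr ltn_add2l ltn_ord.
rewrite det_ublock; congr (_ * _).
rewrite (@det_natmx_upper v (fun a b => g (w + a)%N (w + b)%N)) // => a b /andP[ba av].
by rewrite g1 // ?leq_addr ?ltn_add2l.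
Qed.

Lemma det_natmx_lblock_unit m q g :
  (forall a b, (a < m)%N -> (b < q)%N -> g a (m + b)%N = 0) ->
  (forall a b, (a < q)%N -> (b < q)%N -> g (m + a)%N (m + b)%N = (a == b)%:R) ->
  \det (natmx (m + q) g) = \det (natmx m g).
Proof.
move=> g0 g1.
have -> : natmx (m + q) g =
    block_mx (natmx m g) 0 (\matrix_(a < q, b < m) g (m + a)%N b) 1%:M.
  apply/matrixP => a b; rewrite mxE -[a]splitK -[b]splitK.
  case: (split a) => a'; case: (split b) => b';
    rewrite /= ?block_mxEul ?block_mxEur ?block_mxEdl ?block_mxEdr !mxE //=.
    by rewrite g0.
  by rewrite g1.
by rewrite det_lblock det1 mulr1.
Qed.

Lemma sum_blocks B n g :
  \sum_(s < B * n) g (s %/ n)%N (s %% n)%N = \sum_(b < B) \sum_(j < n) g b j.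
Proof.
elim: B => [|B IH]; first by rewrite !big_ord0.
rewrite [RHS]big_ord_recr /= -IH mulSnr big_split_ord /=; congr (_ + _).
by apply: eq_bigr => j _; rewrite divnMDl ?modnMDl ?divn_small ?modn_small ?addn0 //
  (leq_ltn_trans _ (ltn_ord j)).
Qed.

End NatMatrices.

Notation natmx S g :=
  (\matrix_(a < S, b < S) g (nat_of_ord a) (nat_of_ord b)) (only parsing).

Section PsiColumns.
(** The order of the columns that makes the trailing minor of the transformed staircase
    matrix block triangular: the remaining columns of the block column cut by the minor,
    then the first columns of the following block columns, and then, for the row (d, x), the
    column (d - 1, x + 1), which has its pivot in that row. *)
Definition psi_col (n p i b : nat) : nat :=
  if (b < p - i)%N then (p * n + i + b)%N
  else if (b < n - i)%N then ((p + (b - (p - i))) * n.+1)%N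
  else (((p * n + i + b) %/ n).-1 * n.+1 + ((p * n + i + b) %% n).+1)%N.

Variables (n p i : nat).
Hypotheses (pn : (p < n)%N) (ip : (i <= p)%N).

Lemma psi_row_tail a : (n - i <= a)%N -> (p < (p * n + i + a) %/ n)%N.
Proof.
have n0 : (0 < n)%N by apply: leq_ltn_trans pn.
by move=> wa; rewrite leq_divRL // mulSn; lia.
Qed.

Lemma psi_col_ge b : (p * n + i <= psi_col n p i b)%N.
Proof.
have r0p : (p * n + i <= p * n.+1)%N by rewrite mulnS addnC leq_add2r.
rewrite /psi_col; case: ltnP => bq; first exact: leq_addr.
case: ltnP => bw; first by apply: (leq_trans r0p); rewrite leq_mul2r leq_addr orbT.
have rt := psi_row_tail bw.
apply: (leq_trans r0p); apply: leq_trans (leq_addr _ _).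
by rewrite leq_mul2r /= -ltnS prednK // (leq_ltn_trans _ rt).
Qed.

Lemma psi_col_inj b c : psi_col n p i b = psi_col n p i c -> b = c.
Proof.
have n0 : (0 < n)%N by apply: leq_ltn_trans pn.
have tail := psi_row_tail.
have mod0 x : (p - i <= x)%N -> (x < n - i)%N -> (psi_col n p i x %% n.+1 = 0)%N.
  by move=> h1 h2; rewrite /psi_col ltnNge h1 h2 /= modnMl.
have modS x : (p - i <= x)%N -> (n - i <= x)%N ->
  (psi_col n p i x %% n.+1 = ((p * n + i + x) %% n).+1)%N.
  by move=> h1 h2; rewrite /psi_col !ltnNge h1 h2 /= modnMDl modn_small // ltnS ltn_mod.
have divS x : (p - i <= x)%N -> (n - i <= x)%N ->
  (psi_col n p i x %/ n.+1 = ((p * n + i + x) %/ n).-1)%N.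
  move=> h1 h2; rewrite /psi_col !ltnNge h1 h2 /= divnMDl //.
  have lt : (((p * n + i + x) %% n).+1 < n.+1)%N by rewrite ltnS ltn_mod.
  by rewrite (divn_small lt) addn0.
have small x : (x < p - i)%N = (psi_col n p i x < p * n.+1)%N.
  rewrite /psi_col; case: ifP => [xq|/negbT]; first by rewrite mulnS; lia.
  rewrite -leqNgt => qx; case: ifP => [xw|/negbT]; first by rewrite ltn_mul2r /=; lia.
  rewrite -leqNgt => wx; apply/esym/negbTE; rewrite -leqNgt.
  apply: leq_trans (leq_addr _ _); rewrite leq_mul2r /= -ltnS prednK ?tail //.
  by apply: leq_ltn_trans (tail _ wx).
move=> E; have := small b; rewrite E -small.
have [bq|qb] := ltnP b (p - i).
  by move/esym => cq; move: E; rewrite /psi_col bq cq => /addnI.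
move/esym/negbT; rewrite -leqNgt => qc.
have [bw|wb] := ltnP b (n - i); have [cw|wc] := ltnP c (n - i).
- move: E; rewrite /psi_col !ltnNge qb qc /= -!ltnNge bw cw => /eqP.
  by rewrite eqn_pmul2r // eqn_add2l => /eqP; lia.
- by have := mod0 _ qb bw; rewrite E modS.
- by have := mod0 _ qc cw; rewrite -E modS.
have Em := modS _ qb wb; have Ed := divS _ qb wb.
rewrite E modS // in Em; rewrite E divS // in Ed.
apply: (@addnI (p * n + i)%N).
have lb := tail _ wb; have lc := tail _ wc.
rewrite (divn_eq (p * n + i + b) n) (divn_eq (p * n + i + c) n).
by case: Em => ->; congr (_ * _ + _)%N; lia.
Qed.

Lemma psi_col_lt b : (b < n ^ 2 - (p * n + i))%N -> (psi_col n p i b < n ^ 2)%N.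
Proof.
move=> bS; rewrite /psi_col; case: ifP => [_|_]; first by lia.
case: ifP => [bw|/negbT]; first by rewrite -mulnn; nia.
have n0 : (0 < n)%N by apply: leq_ltn_trans pn.
rewrite -leqNgt => wb.
have pd : (p < (p * n + i + b) %/ n)%N by rewrite leq_divRL // mulSn; lia.
have dn : ((p * n + i + b) %/ n < n)%N by rewrite ltn_divLR // mulnn; lia.
have mn : ((p * n + i + b) %% n < n)%N by rewrite ltn_mod.
move: pd dn mn; set d := (_ %/ n)%N; set x := (_ %% n)%N => pd dn xn.
by rewrite -mulnn; nia.
Qed.

End PsiColumns.

Section PhiFactorization.
Variables (F : fieldType) (n : nat).
Hypothesis n0 : (0 < n)%N.
Implicit Types X Y : 'M[F]_n.+1.

(** The entries of [Psi] as a function of natural numbers, with full blocks everywhere. *)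
Definition psi_nat X Y (r s : nat) : F :=
  let a := (r %/ n)%N in let b := (s %/ n.+1)%N in
  if a == b then Y (inord (r %% n).+1) (inord (s %% n.+1))
  else if a == b.+1 then X (inord (r %% n).+1) (inord (s %% n.+1)) else 0.

Lemma phi_nat X Y r0 : (r0 < n ^ 2)%N ->
  phi r0.+1 X Y = \det (natmx (n ^ 2 - r0) (fun a b => psi_nat X Y (r0 + a) (r0 + b))).
Proof.
move=> r0n; rewrite /phi /Delta.
have lt (a : 'I_(n ^ 2 - r0)) : (r0 + a < n ^ 2)%N by have := ltn_ord a; lia.
congr (\det _); apply/matrixP => a b.
rewrite !mxE addSn (ent_lt _ (lt a) (lt b)) mxE /= /psi_nat.
have im : ((r0 + a) %% n < n)%N by rewrite ltn_mod.
have jm : ((r0 + b) %% n.+1 < n.+1)%N by rewrite ltn_mod.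
have E (A : 'M[F]_n.+1) : ent A ((r0 + a) %% n).+2 ((r0 + b) %% n.+1).+1 =
    A (inord ((r0 + a) %% n).+1) (inord ((r0 + b) %% n.+1)) :> F.
  rewrite (@ent_lt _ _ _ A ((r0 + a) %% n).+1 _ im jm).
  by congr (A _ _); apply: val_inj; rewrite /= inordK.
by rewrite !E.
Qed.

Variables (X Y : 'M[F]_n.+1) (p i : nat).
Hypothesis Xtrig : is_trig_mx X^T.
Hypothesis Xunit : X \in unitmx.
Hypothesis pn : (p < n)%N.
Hypothesis ip : (i <= p)%N.

Let Z := invmx X *m Y.
Let first_vec : 'cV[F]_n.+1 := \col_j (j == 0 :> nat)%:R.
Let chain (l : nat) : 'cV[F]_n.+1 := (- Z) ^+ l *m first_vec.
Let r0 := (p * n + i)%N.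

Let basis_vec (j : nat) : 'cV[F]_n.+1 := \col_h (h == j :> nat)%:R.

(* The block at height b of column t of the change of basis, a unitriangular matrix.  A
   column (b, j) with j > 0 becomes X_jj X^-1 e_j in block b, so that the X below it retains
   the single entry X_jj, a pivot.  In a column (b, 0), the vector e_1 is extended upwards
   by the chain (-Z)^(b - b') e_1 in the blocks b' from p to b: as X (-Z) v + Y v = 0, and
   as X e_1 is zero outside the first row, nothing remains below block row p.  The columns
   of the blocks before p are left alone. *)
Let block (t b : nat) : 'cV[F]_n.+1 :=
  if (t < p * n.+1)%N then
    if b == (t %/ n.+1)%N then basis_vec (t %% n.+1) else 0
  else if (t %% n.+1 == 0)%N then
    if (p <= b <= t %/ n.+1)%N then chain (t %/ n.+1 - b) else 0
  else
    if b == (t %/ n.+1)%N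
    then X (inord (t %% n.+1)) (inord (t %% n.+1)) *: (invmx X *m basis_vec (t %% n.+1))
    else 0.

Let change (s t : nat) : F := block t (s %/ n.+1) (inord (s %% n.+1)) ord0.

Lemma upper_entry0 (a b : 'I_n.+1) : (b < a)%N -> X a b = 0.
Proof. by move=> ba; have /is_trig_mxP/(_ b a ba) := Xtrig; rewrite mxE. Qed.

Lemma upper_diag_neq0 (a : 'I_n.+1) : X a a != 0.
Proof.
have := Xunit; rewrite unitmxE -det_tr det_trig // unitfE => /prodf_neq0 /(_ a isT).
by rewrite mxE.
Qed.

Lemma inv_upper_entry0 (a b : 'I_n.+1) : (b < a)%N -> invmx X a b = 0.
Proof.
(* The rows of the inverse are treated from the bottom upwards. *)
have [m] := ubnP (n.+1 - a); elim: m a b => // m IH a b am ba.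
have : (X *m invmx X) a b = 0 by rewrite mulmxV // mxE -val_eqE /= gtn_eqF.
rewrite mxE (bigD1 a) //= big1 ?addr0 => [/eqP|c ca].
  by rewrite mulf_eq0 (negPf (upper_diag_neq0 a)) => /eqP.
have [ac|] := ltnP a c; last by rewrite leq_eqVlt val_eqE (negPf ca) /= => /upper_entry0 ->;
  rewrite mul0r.
by rewrite (IH c b) ?mulr0 ?(ltn_trans ba) //; have := ltn_ord c; lia.
Qed.

Lemma diag_mul_inv (a : 'I_n.+1) : X a a * invmx X a a = 1.
Proof.
have : (X *m invmx X) a a = 1 by rewrite mulmxV // mxE eqxx.
rewrite mxE (bigD1 a) //= big1 ?addr0 // => c ca.
have [ac|] := ltnP a c; first by rewrite inv_upper_entry0 ?mulr0.
by rewrite leq_eqVlt val_eqE (negPf ca) /= => /upper_entry0 ->; rewrite mul0r.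
Qed.

Lemma mulmx_basis_vec (A : 'M[F]_n.+1) j (h : 'I_n.+1) : (j < n.+1)%N ->
  (A *m basis_vec j) h ord0 = A h (inord j).
Proof.
move=> jn; rewrite mxE (bigD1 (inord j)) //= big1 ?addr0 => [|k kj].
  by rewrite mxE inordK // eqxx mulr1.
rewrite mxE (_ : (k == j :> nat) = false) ?mulr0 //.
by apply: contraNF kj => /eqP E; apply/eqP/val_inj; rewrite /= inordK.
Qed.

Lemma inord_modK u : nat_of_ord (inord (u %% n.+1) : 'I_n.+1) = (u %% n.+1)%N.
Proof. by rewrite inordK ?ltn_mod. Qed.

Lemma change_upper s t : (t < s)%N -> change s t = 0.
Proof.
move=> ts; have tsd : (t %/ n.+1 <= s %/ n.+1)%N by rewrite leq_div2r // ltnW.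
have modlt : (s %/ n.+1 = t %/ n.+1)%N -> (t %% n.+1 < s %% n.+1)%N.
  by move: ts; rewrite {1}(divn_eq t n.+1) {1}(divn_eq s n.+1) => + E; rewrite E ltn_add2l.
rewrite /change /block; case: ifP => _.
  case: eqP => [/modlt lt|_]; last by rewrite mxE.
  by rewrite mxE inord_modK gtn_eqF.
case: ifP => [t0|_].
  case: ifP => [/andP[_ le]|_]; last by rewrite mxE.
  have E : (s %/ n.+1 = t %/ n.+1)%N by apply/eqP; rewrite eqn_leq le tsd.
  have := modlt E; rewrite E subnn /chain expr0 mul1mx mxE inord_modK (eqP t0).
  by rewrite lt0n => /negPf ->.
case: eqP => [/modlt lt|_]; last by rewrite mxE.
rewrite mxE mulmx_basis_vec ?ltn_mod // inv_upper_entry0 ?mulr0 //.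
by rewrite !inord_modK.
Qed.

Lemma change_diag t : change t t = 1.
Proof.
rewrite /change /block; case: ifP => [_|tp]; first by rewrite eqxx mxE inord_modK eqxx.
case: ifP => [t0|_].
  rewrite leqnn andbT leq_divRL // leqNgt tp subnn /chain expr0 mul1mx mxE inord_modK.
  by rewrite (eqP t0).
by rewrite eqxx mxE mulmx_basis_vec ?ltn_mod // diag_mul_inv.
Qed.

Lemma change_left s t : (s < r0 <= t)%N -> change s t = 0.
Proof.
move=> /andP[sr rt]; rewrite /change /block.
have sp : (s < p * n.+1)%N by rewrite /r0 in sr; lia.
have spd : (s %/ n.+1 < p)%N by rewrite ltn_divLR.
case: ifP => [tp|tp].
  case: eqP => [E|_]; last by rewrite mxE.
  rewrite mxE inordK ?ltn_mod // (_ : (_ == _) = false) //.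
  apply: contraTF sr => /eqP E'; rewrite -leqNgt.
  by rewrite (divn_eq s n.+1) E E' -divn_eq.
case: ifP => [t0|_].
  by rewrite leqNgt spd mxE.
case: eqP => [E|_]; last by rewrite mxE.
by move: tp; rewrite -ltn_divLR // -E spd.
Qed.

(* The product of Psi with the change of basis: a row of Psi meets a block Y and, to the
   left of it, a block X. *)
Let psi_change (r t : nat) : F :=
  (Y *m block t (r %/ n)) (inord (r %% n).+1) ord0 +
  (if (0 < r %/ n)%N then (X *m block t (r %/ n).-1) (inord (r %% n).+1) ord0 else 0).

Lemma psi_mul_change r t : (r < n ^ 2)%N -> (r0 <= t < n ^ 2)%N ->
  \sum_(c < n ^ 2 - r0) psi_nat X Y r (r0 + c) * change (r0 + c) t = psi_change r t.
Proof.
move=> rn /andP[r0t tn].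
have S2 : (n ^ 2 <= n * n.+1)%N by rewrite -mulnn leq_mul2l leqnSn orbT.
have r0n : (r0 <= n ^ 2)%N by apply: leq_trans r0t (ltnW tn).
have -> : \sum_(c < n ^ 2 - r0) psi_nat X Y r (r0 + c) * change (r0 + c) t =
          \sum_(s < n * n.+1) psi_nat X Y r s * change s t.
  rewrite -(big_mkord xpredT (fun s => psi_nat X Y r s * change s t)).
  rewrite (big_cat_nat (leq0n r0) (leq_trans r0n S2)) /=.
  rewrite (big_cat_nat r0n S2) /=.
  rewrite [X in _ = X + _]big_nat_cond [X in _ = X + _]big1 ?add0r; last first.
    by move=> s /andP[/andP[_ sr] _]; rewrite change_left ?mulr0 // sr.
  rewrite [X in _ = _ + X]big_nat_cond [X in _ = _ + X]big1 ?addr0; last first.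
    by move=> s /andP[/andP[sr _] _]; rewrite change_upper ?mulr0 // (leq_trans tn).
  have := big_addn 0 (n ^ 2) r0 xpredT (fun s => psi_nat X Y r s * change s t).
  rewrite add0n => ->; rewrite big_mkord.
  by apply: eq_bigr => c _; rewrite addnC.
pose G (b j : nat) : F := (if (r %/ n == b)%N then Y (inord (r %% n).+1) (inord j) else
   if (r %/ n == b.+1)%N then X (inord (r %% n).+1) (inord j) else 0) * block t b (inord j) ord0.
rewrite (eq_bigr (fun s : 'I_(n * n.+1) => G (s %/ n.+1)%N (s %% n.+1)%N)) //.
rewrite sum_blocks /psi_change.
have rd : (r %/ n < n)%N by rewrite ltn_divLR // mulnn.
have row (A : 'M[F]_n.+1) b :
    \sum_(j < n.+1) A (inord (r %% n).+1) (inord j) * block t b (inord j) ord0 =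
    (A *m block t b) (inord (r %% n).+1) ord0.
  by rewrite mxE; apply: eq_bigr => j _; rewrite inord_val.
rewrite (bigD1 (Ordinal rd)) //=; congr (_ + _).
  by rewrite -row; apply: eq_bigr => j _; rewrite /G eqxx.
case: ifP => r1; last first.
  apply: big1 => b brd; apply: big1 => j _; rewrite /G.
  rewrite ifN; last by apply: contraNneq brd => E; apply/eqP/val_inj.
  by rewrite ifN ?mul0r //; apply: contraFneq r1 => ->.
have rd1 : ((r %/ n).-1 < n)%N by apply: leq_ltn_trans (leq_pred _) rd.
rewrite (bigD1 (Ordinal rd1)) /=; last by rewrite -val_eqE /= ltn_eqF // ltn_predL.
rewrite [X in _ + X]big1 ?addr0 => [|b /andP[b1 b2]].
  rewrite -row; apply: eq_bigr => j _; rewrite /G prednK // eqxx ifN //.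
  by rewrite gtn_eqF // ltn_predL.
apply: big1 => j _; rewrite /G ifN; last by apply: contraNneq b1 => E; apply/eqP/val_inj.
rewrite ifN ?mul0r //; apply: contraNneq b2 => E; apply/eqP/val_inj.
by rewrite /= E.
Qed.

(* The block row p has w rows below the cut; they meet q columns of the block column p - 1
   to the right of the cut, and m chains; w = q + m. *)
Let w := (n - i)%N.
Let q := (p - i)%N.
Let m := (n - p)%N.

Lemma row_index_head a : (a < w)%N -> ((r0 + a) %/ n = p)%N /\ ((r0 + a) %% n = i + a)%N.
Proof.
move=> aw; have ian : (i + a < n)%N by rewrite /w in aw; lia.
by rewrite /r0 -addnA divnMDl // modnMDl divn_small // modn_small // addn0.
Qed.

Let row_index_tail a (wa : (w <= a)%N) : (p < (r0 + a) %/ n)%N := psi_row_tail pn ip wa.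

Lemma block_unit b h : (b < q)%N -> block (psi_col n p i b) h =
  if (h == p.-1) && (0 < p)%N then basis_vec (n.+1 - q + b) else 0.
Proof.
move=> bq; rewrite /block /psi_col -/q bq -/r0.
have rb : (r0 + b)%N = (p.-1 * n.+1 + (n.+1 - q + b))%N.
  by rewrite /r0; rewrite /q in bq *; nia.
have lt : (n.+1 - q + b < n.+1)%N by rewrite /q in bq *; lia.
have p0 : (0 < p)%N by rewrite /q in bq; lia.
rewrite p0 andbT ifT; last by rewrite -{1}(prednK p0) rb mulSn addnC ltn_add2r.
by rewrite rb divnMDl // modnMDl divn_small // modn_small // addn0.
Qed.

Lemma block_chain b h : (q <= b < w)%N -> block (psi_col n p i b) h =
  if (p <= h <= p + (b - q))%N then chain (p + (b - q) - h) else 0.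
Proof.
move=> /andP[qb bw]; rewrite /block /psi_col -/q -/w bw (ltnNge b) qb /=.
by rewrite ltn_mul2r /= ltnNge leq_addr /= modnMl eqxx mulnK.
Qed.

Lemma block_pivot b h : (w <= b)%N -> block (psi_col n p i b) h =
  if h == ((r0 + b) %/ n).-1 then
    let j : 'I_n.+1 := inord ((r0 + b) %% n).+1 in X j j *: (invmx X *m basis_vec j)
  else 0.
Proof.
move=> wb; have qw : (q <= w)%N by rewrite /q /w leq_sub2r // ltnW.
have lt : (((r0 + b) %% n).+1 < n.+1)%N by rewrite ltnS ltn_mod.
have d0 := leq_ltn_trans (leq0n _) (row_index_tail wb).
have -> : psi_col n p i b = (((r0 + b) %/ n).-1 * n.+1 + ((r0 + b) %% n).+1)%N.
  by rewrite /psi_col -/q -/w -/r0 !ifN -?leqNgt // (leq_trans qw).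
rewrite /block ifN; last first.
  rewrite -leqNgt; apply: leq_trans (leq_addr _ _); rewrite leq_mul2r /= -ltnS prednK //.
  exact: row_index_tail.
by rewrite modnMDl (modn_small lt) /= divnMDl // (divn_small lt) addn0 (inordK lt).
Qed.

Lemma X_chain l : X *m chain l.+1 = - (Y *m chain l).
Proof.
rewrite /chain exprS -[_ * _]/(_ *m _) !mulmxA mulmxN {1}/Z mulmxA mulmxV // mul1mx.
by rewrite !mulNmx.
Qed.

Lemma psi_change_low a b : (w <= a)%N -> (b < w)%N -> psi_change (r0 + a) (psi_col n p i b) = 0.
Proof.
move=> wa bw; have pr := row_index_tail wa; rewrite /psi_change.
have r1 : (0 < (r0 + a) %/ n)%N by apply: leq_ltn_trans pr.
rewrite r1; set d := ((r0 + a) %/ n)%N in pr r1 *.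
have [bq|qb] := ltnP b q.
  rewrite !block_unit // !ifN ?mulmx0 ?mxE ?addr0 //.
  - by rewrite negb_and; apply/orP; left; lia.
  - by rewrite negb_and; apply/orP; left; lia.
rewrite !block_chain ?qb //; set l := (b - q)%N.
have [dl|ld] := leqP d (p + l).
  rewrite (ltnW pr) ifT; last by lia.
  have -> : (p + l - d.-1 = (p + l - d).+1)%N by lia.
  by rewrite X_chain !mxE subrr.
rewrite andbF mulmx0 mxE add0r; case: ifP => [/andP[_ h]|_]; last by rewrite mulmx0 mxE.
have -> : (p + l - d.-1 = 0)%N by lia.
rewrite /chain expr0 mul1mx mxE big1 // => j _; rewrite mxE.
have [j0|j0] := eqVneq (j : nat) 0%N; last by rewrite mulr0.
by rewrite upper_entry0 ?mul0r // j0 inordK // ltnS ltn_mod.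
Qed.

Lemma psi_change_pivot a b : (w <= b <= a)%N ->
  psi_change (r0 + a) (psi_col n p i b) =
  if a == b then let j : 'I_n.+1 := inord ((r0 + a) %% n).+1 in X j j else 0.
Proof.
move=> /andP[wb ba]; have wa := leq_trans wb ba; rewrite /psi_change.
have ra := row_index_tail wa; have rb := row_index_tail wb.
have dd : ((r0 + b) %/ n <= (r0 + a) %/ n)%N by rewrite leq_div2r // leq_add2l.
rewrite (leq_ltn_trans (leq0n _) ra) !block_pivot //.
rewrite [X in Y *m X]ifN ?mulmx0 ?[X in X + _]mxE ?add0r; last by lia.
case: eqP => [E|E]; last first.
  rewrite mulmx0 mxE ifN //; apply: contra_not_neq E => ->.
  by [].
have {}E : ((r0 + a) %/ n = (r0 + b) %/ n)%N by lia.
rewrite /= -scalemxAr mulmxA mulmxV // mul1mx !mxE inordK ?ltnS ?ltn_mod //.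
rewrite inordK ?ltnS ?ltn_mod // eqSS.
have -> : (r0 + a == r0 + b %[mod n])%N = (a == b).
  apply/eqP/eqP => [E'|-> //]; apply: (@addnI r0).
  by rewrite (divn_eq (r0 + a) n) (divn_eq (r0 + b) n) E E'.
by case: eqP => [->|_]; rewrite ?mulr1 ?mulr0.
Qed.

(* The first w rows and columns, after multiplication by the inverse of the triangular
   matrix of the last w rows and columns of X. *)
Let head (a b : nat) : F :=
  if (b < q)%N then (a == m + b)%N%:R
  else (Z *m chain (b - q)) (inord (i.+1 + a)) ord0.

Lemma psi_change_head a b : (a < w)%N -> (b < w)%N ->
  psi_change (r0 + a) (psi_col n p i b) =
  \sum_(c < w) X (inord (i.+1 + a)) (inord (i.+1 + c)) * head c b.
Proof.
move=> aw bw; have [dE mE] := row_index_head aw; rewrite /psi_change dE mE.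
have iw : (i.+1 + w = n.+1)%N by rewrite /w; lia.
have split_row (v : 'cV[F]_n.+1) : (X *m v) (inord (i.+1 + a)) ord0 =
    \sum_(c < w) X (inord (i.+1 + a)) (inord (i.+1 + c)) * v (inord (i.+1 + c)) ord0.
  rewrite mxE.
  pose f c := X (inord (i.+1 + a)) (inord c) * v (inord c) ord0.
  rewrite (eq_bigr (fun c : 'I_n.+1 => f c)); last by move=> c _; rewrite /f inord_val.
  rewrite -[RHS]/(\sum_(c < w) f (i.+1 + c)%N) -(big_mkord xpredT f) -iw.
  rewrite big_mkord big_split_ord /= big1 ?add0r // => c _.
  by rewrite /f upper_entry0 ?mul0r // !inordK; have := ltn_ord c; rewrite /w in aw; lia.
have [bq|qb] := ltnP b q.
  have p0 : (0 < p)%N by rewrite /q in bq; lia.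
  rewrite !block_unit // p0 andbT eqxx ifN; last by lia.
  rewrite mulmx0 mxE add0r -addSn split_row; apply: eq_bigr => c _.
  rewrite mxE /head bq; congr (_ * _%:R); have cw := ltn_ord c.
  rewrite inordK; last by lia.
  by congr nat_of_bool; apply/eqP/eqP; rewrite /q /m in bq *; lia.
rewrite !block_chain ?qb // leqnn leq_addr /= -addSn.
have -> : (p + (b - q) - p = b - q)%N by lia.
have -> : (if (0 < p)%N then
    (X *m (if (p <= p.-1 <= p + (b - q))%N then chain (p + (b - q) - p.-1) else 0))
      (inord (i.+1 + a)) ord0 else 0) = 0.
  case: ifP => // p0; rewrite ifN ?mulmx0 ?mxE //.
  by rewrite negb_and -ltnNge ltn_predL p0.
rewrite addr0 -(mulKVmx Xunit (Y *m _)) split_row.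
by apply: eq_bigr => c _; rewrite /head ltnNge qb /= /Z mulmxA.
Qed.

(** The rows avoid the first one, where alone [e_1] is nonzero: hence the binomial expansion
    of [Z^(b + 1) e_1 = ((Z - 1) + 1)^(b + 1) e_1] has no constant term there, and the
    coefficients form a triangular matrix. *)
Lemma chain_in_powers (a b : nat) : (a < m)%N -> (b < m)%N ->
  (Z *m chain b) (inord (i.+1 + a)) ord0 =
  \sum_(j < m) ((Z - 1) ^+ j.+1 *m first_vec) (inord (i.+1 + a)) ord0 *
               ((-1) ^+ b * 'C(b.+1, j.+1)%:R).
Proof.
move=> am bm; set h : 'I_n.+1 := inord _.
have hE : h = (i.+1 + a)%N :> nat by rewrite /h inordK //; rewrite /m in am; lia.
have h0 : h != 0%N :> nat by rewrite hE.
have -> : Z *m chain b = (-1) ^+ b *: (((Z - 1) + 1) ^+ b.+1 *m first_vec).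
  rewrite /chain mulmxA subrK scalemxAl; congr (_ *m _).
  by rewrite -[LHS]/(Z * _) -scaleN1r exprZn -scalerAr -exprS.
rewrite exprD1n big_ord_recl /= expr0 mulr1n mulmxDl mul1mx mulmx_suml.
rewrite [LHS]mxE [X in _ * X]mxE [X in _ * (X + _)]mxE (negPf h0) add0r summxE mulr_sumr.
rewrite -(big_mkord xpredT (fun j =>
  (-1) ^+ b * (((Z - 1) ^+ j.+1 *+ 'C(b.+1, j.+1)) *m first_vec) h ord0)).
rewrite -[RHS](big_mkord xpredT (fun j =>
  ((Z - 1) ^+ j.+1 *m first_vec) h ord0 * ((-1) ^+ b * 'C(b.+1, j.+1)%:R))).
rewrite [RHS](big_cat_nat (n := b.+1)) //=.
rewrite [X in _ = _ + X]big_nat_cond [X in _ = _ + X]big1 ?addr0; last first.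
  by move=> j /andP[/andP[bj _] _]; rewrite bin_small ?ltnS // mulr0 mulr0.
apply: eq_bigr => j _.
rewrite -scaler_nat -scalemxAl mxE; ring.
Qed.

(* The first hypothesis reorders all the columns; the second one moves the m chains of the
   head before the q columns.  As hypotheses, they give signs that are chosen before X
   and Y. *)
Variables (e e' : bool).
Hypothesis reorder : forall g,
  \det (natmx (n ^ 2 - r0) g) =
  (-1) ^+ e * \det (natmx (n ^ 2 - r0) (fun a b => g a (psi_col n p i b - r0)%N)) :> F.
Hypothesis rotate : forall g,
  \det (natmx w g) =
  (-1) ^+ e' * \det (natmx w (fun a b => g a (if (b < m)%N then (q + b)%N else (b - m)%N))) :> F.

Lemma det_psi_factor :
  \det (natmx (n ^ 2 - r0) (fun a b => psi_nat X Y (r0 + a) (r0 + b))) =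
  (-1) ^+ e * (-1) ^+ e' * (-1) ^+ (\sum_(b < m) b) *
  ((\prod_(a < w) X (inord (i.+1 + a)) (inord (i.+1 + a))) *
   (\prod_(a < n ^ 2 - r0 - w)
      X (inord ((r0 + (w + a)) %% n).+1) (inord ((r0 + (w + a)) %% n).+1))) *
  \det (natmx m (fun a j => ((Z - 1) ^+ j.+1 *m first_vec) (inord (i.+1 + a)) ord0)).
Proof.
set S := (n ^ 2 - r0)%N.
have wS : (w <= S)%N by rewrite /S /w /r0; rewrite -mulnn; nia.
have psiT : \det (natmx S (fun a b => psi_nat X Y (r0 + a) (r0 + b))) =
            \det (natmx S (fun a b => psi_change (r0 + a) (r0 + b))).
  have detT : \det (natmx S (fun a b => change (r0 + a) (r0 + b))) = 1.
    rewrite (@det_natmx_upper _ _ (fun a b => change (r0 + a) (r0 + b))) => [|a b /andP[ba _]].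
      by rewrite big1 // => a _; rewrite change_diag.
    by rewrite change_upper // ltn_add2l.
  rewrite -[LHS]mulr1 -detT -det_mulmx (natmx_mul _ (fun a b =>
    psi_nat X Y (r0 + a) (r0 + b)) (fun a b => change (r0 + a) (r0 + b))).
  congr (\det _); apply/matrixP => a b; rewrite !mxE psi_mul_change //.
    by have := ltn_ord a; rewrite /S; lia.
  by have := ltn_ord b; rewrite /S leq_addr; lia.
rewrite psiT (reorder (fun a b => psi_change (r0 + a) (r0 + b))) -/S.
have -> : \det (natmx S (fun a b => psi_change (r0 + a) (r0 + (psi_col n p i b - r0)))) =
          \det (natmx (w + (S - w)) (fun a b => psi_change (r0 + a) (psi_col n p i b))).
  by rewrite (subnKC wS); congr (\det _); apply/matrixP => a b;
    rewrite !mxE (subnKC (psi_col_ge pn ip b)).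
rewrite (@det_natmx_ublock _ _ _ (fun a b => psi_change (r0 + a) (psi_col n p i b))); first last.
- move=> a b /andP[wb ba] _; rewrite psi_change_pivot ?wb ?(ltnW ba) //.
  by rewrite gtn_eqF.
- by move=> a b /andP[wa _] bw; rewrite psi_change_low.
have -> : \prod_(a < S - w) psi_change (r0 + (w + a)) (psi_col n p i (w + a)) =
  \prod_(a < S - w) X (inord ((r0 + (w + a)) %% n).+1) (inord ((r0 + (w + a)) %% n).+1).
  by apply: eq_bigr => a _; rewrite psi_change_pivot ?leq_addr ?leqnn // eqxx.
have -> : \det (natmx w (fun a b => psi_change (r0 + a) (psi_col n p i b))) =
   (\prod_(a < w) X (inord (i.+1 + a)) (inord (i.+1 + a))) * \det (natmx w head).
  rewrite -(@det_natmx_upper _ w (fun a b => X (inord (i.+1 + a)) (inord (i.+1 + b)))).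
    rewrite -det_mulmx (natmx_mul _ (fun a b => X (inord (i.+1 + a)) (inord (i.+1 + b))) head).
    by congr (\det _); apply/matrixP => a b; rewrite !mxE psi_change_head.
  move=> a b /andP[ba aw]; rewrite upper_entry0 // !inordK; rewrite /w in aw; lia.
have -> : \det (natmx w head) = (-1) ^+ e' * \det (natmx m (fun a b =>
  (Z *m chain b) (inord (i.+1 + a)) ord0)).
  rewrite (rotate head); have wmq : w = (m + q)%N by rewrite /w /m /q; lia.
  rewrite wmq (@det_natmx_lblock_unit _ m q (fun a b => head a (if (b < m)%N then (q + b)%N else
    (b - m)%N))); first congr (_ * \det _).
  - apply/matrixP => a b; rewrite [LHS]mxE [RHS]mxE ltn_ord.
    by rewrite /head (ltnNge (q + b)%N) leq_addr /= addKn.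
  - move=> a b am bq; rewrite ltnNge leq_addr /= /head addKn bq.
    by rewrite ltn_eqF // (leq_trans am) // leq_addr.
  - move=> a b aq bq; rewrite ltnNge leq_addr /= /head addKn bq.
    by rewrite eqn_add2l.
have -> : \det (natmx m (fun a b => (Z *m chain b) (inord (i.+1 + a)) ord0)) =
   \det (natmx m (fun a j => ((Z - 1) ^+ j.+1 *m first_vec) (inord (i.+1 + a)) ord0)) *
   (-1) ^+ (\sum_(b < m) b).
  pose U (j b : nat) : F := (-1) ^+ b * 'C(b.+1, j.+1)%:R.
  have <- : \det (natmx m U) = (-1) ^+ (\sum_(b < m) b).
    rewrite (@det_natmx_upper _ m U) => [|a b /andP[ba _]]; last by rewrite /U bin_small ?mulr0.
    rewrite (big_morph (fun k => (-1) ^+ k) (exprD _) (expr0 _)).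
    by apply: eq_bigr => b _; rewrite /U binn mulr1.
  rewrite -det_mulmx (natmx_mul _ (fun a j =>
    ((Z - 1) ^+ j.+1 *m first_vec) (inord (i.+1 + a)) ord0) U).
  by congr (\det _); apply/matrixP => a b; rewrite [LHS]mxE [RHS]mxE chain_in_powers.
ring.
Qed.

End PhiFactorization.

Lemma Delta_Fmx (R : comNzRingType) (n p i : nat) (W : 'M[R]_n.+1) :
  (p < n)%N -> (i <= p)%N ->
  Delta (Fmx W) i.+2 (n.+1 - p + i.+1 - 1) 1 =
  \det (natmx (n - p) (fun a j =>
    (W ^+ j.+1 *m (\col_h (h == 0 :> nat)%:R)) (inord (i.+1 + a)) ord0)).
Proof.
move=> pn ip; rewrite /Delta.
have -> : ((n.+1 - p + i.+1 - 1).+1 - i.+2 = n - p)%N by lia.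
congr (\det _); apply/matrixP => a b; rewrite [LHS]mxE [RHS]mxE addSn add1n.
have ha : (i.+1 + a < n.+1)%N by have := ltn_ord a; lia.
have hb : (b < n.+1)%N by have := ltn_ord b; lia.
rewrite (ent_lt _ ha hb) mxE; congr ((_ *m _) _ _).
by apply: val_inj; rewrite /= inordK.
Qed.

(** The sign and the list of diagonal entries are the same for all [X] and [Y], so that the
    identity holds along the whole chart. *)
Theorem phi_factorization (F : fieldType) (n p i : nat) : (p < n)%N -> (i <= p)%N ->
  exists (e : bool) (r : seq 'I_n.+1), forall X Y : 'M[F]_n.+1,
    is_trig_mx X^T -> X \in unitmx ->
    phi (p * n + i).+1 X Y = (-1) ^+ e * (\prod_(j <- r) X j j) *
      Delta (Fmx (invmx X *m Y - 1)) i.+2 (n.+1 - p + i.+1 - 1) 1.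
Proof.
move=> pn ip; have n0 : (0 < n)%N by apply: leq_ltn_trans pn.
set r0 := (p * n + i)%N; pose w := (n - i)%N; pose q := (p - i)%N; pose m := (n - p)%N.
have r0n : (r0 < n ^ 2)%N by rewrite /r0 -mulnn; nia.
have col_ge b : (r0 <= psi_col n p i b)%N by exact: psi_col_ge pn ip b.
have [e He] : exists e : bool, forall g, \det (natmx (n ^ 2 - r0) g) =
    (-1) ^+ e * \det (natmx (n ^ 2 - r0) (fun a b => g a (psi_col n p i b - r0)%N)) :> F.
  apply: (@det_natmx_reindex _ (n ^ 2 - r0) (fun b => psi_col n p i b - r0)%N) => [b bS|b c _ _ E].
    by rewrite ltn_sub2r // psi_col_lt.
  apply: (psi_col_inj pn ip).
  by rewrite -(subnKC (col_ge b)) E subnKC.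
have [e' He'] : exists e' : bool, forall g, \det (natmx w g) =
    (-1) ^+ e' * \det (natmx w (fun a b => g a (if (b < m)%N then (q + b)%N else (b - m)%N))) :> F.
  apply: (@det_natmx_reindex _ w (fun b => if (b < m)%N then (q + b)%N else (b - m)%N)).
    by move=> b; rewrite /w /q /m; case: ifP; lia.
  by move=> b c; rewrite /w /q /m; do 2 case: ifP; lia.
exists (e (+) e' (+) odd (\sum_(b < m) b)).
exists ([seq inord (i.+1 + a) | a <- iota 0 w] ++
        [seq inord ((r0 + (w + a)) %% n).+1 | a <- iota 0 (n ^ 2 - r0 - w)]).
move=> X Y Xt Xu; rewrite phi_nat // (det_psi_factor n0 Y Xt Xu pn ip He He') Delta_Fmx //.
rewrite !signr_addb signr_odd big_cat /= !big_map.
have iotaE N (f : nat -> F) : \prod_(j <- iota 0 N) f j = \prod_(a < N) f a.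
  by rewrite -(big_mkord xpredT f) /index_iota subn0.
by rewrite !iotaE.
Qed.

(** * Poisson brackets of minors and of characteristic coefficients *)

Section Jacobi.
Variable (S : comNzRingType) (D : S -> S).
Hypothesis Dadd : forall x y, D (x + y) = D x + D y.
Hypothesis Dmul : forall x y, D (x * y) = D x * y + x * D y.

Lemma derivation0 : D 0 = 0.
Proof. by apply: (@addIr _ (D 0)); rewrite add0r -Dadd addr0. Qed.

Lemma derivation1 : D 1 = 0.
Proof. by apply: (@addIr _ (D 1)); rewrite add0r -{3}[1]mulr1 Dmul mulr1 mul1r. Qed.

Lemma derivation_opp x : D (- x) = - D x.
Proof. by apply: (@addIr _ (D x)); rewrite -Dadd !addNr derivation0. Qed.

Lemma derivation_sum (I : Type) (r : seq I) (P : pred I) (F : I -> S) :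
  D (\sum_(i <- r | P i) F i) = \sum_(i <- r | P i) D (F i).
Proof. exact: (big_morph D Dadd derivation0). Qed.

Lemma derivation_prod (I : eqType) (r : seq I) (F : I -> S) : uniq r ->
  D (\prod_(k <- r) F k) = \sum_(i <- r) \prod_(k <- r) (if k == i then D (F k) else F k).
Proof.
elim: r => [|x r IH] /=; first by rewrite !big_nil derivation1.
move=> /andP[xr ur]; rewrite !big_cons eqxx Dmul IH //; congr (_ + _).
  congr (_ * _); apply: eq_big_seq => k kr.
  by rewrite ifN //; apply: contraNneq xr => <-.
rewrite mulr_sumr; apply: eq_big_seq => i ir.
rewrite big_cons ifN //; by apply: contraNneq xr => ->.
Qed.

(** Jacobi's formula: each row contributes the determinant in which it is
    differentiated, which is expanded along that row. *)
Lemma derivation_det m (M : 'M[S]_m) :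
  D (\det M) = \sum_i \sum_j cofactor M i j * D (M i j).
Proof.
rewrite /determinant derivation_sum.
transitivity (\sum_i \det (\matrix_(k, j) if k == i then D (M k j) else M k j)).
  rewrite /determinant exchange_big /=; apply: eq_bigr => s _.
  rewrite -mulr_sumr !mulr_sign (fun_if D) derivation_opp.
  rewrite derivation_prod ?index_enum_uniq //.
  by case: (odd_perm s); [congr (- _)|]; apply: eq_bigr => i _; apply: eq_bigr => k _; rewrite mxE.
apply: eq_bigr => i _; rewrite (expand_det_row _ i); apply: eq_bigr => j _.
rewrite mxE eqxx mulrC; congr (_ * _); rewrite /cofactor; congr (_ * \det _).
by apply/matrixP => k l; rewrite !mxE eq_sym (negPf (neq_lift _ _)).
Qed.

Lemma derivation_polyD (x y : {poly S}) : map_poly D (x + y) = map_poly D x + map_poly D y.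
Proof. by apply/polyP => h; rewrite coefD !coef_map_id0 ?derivation0 // coefD Dadd. Qed.

Lemma derivation_polyM (x y : {poly S}) :
  map_poly D (x * y) = map_poly D x * y + x * map_poly D y.
Proof.
apply/polyP => h; rewrite coefD !coef_map_id0 ?derivation0 // !coefM derivation_sum.
rewrite -big_split; apply: eq_bigr => l _.
by rewrite /= !coef_map_id0 ?derivation0 // Dmul.
Qed.

Lemma derivation_polyC z : map_poly D z%:P = (D z)%:P.
Proof.
apply/polyP => h; rewrite coef_map_id0 ?derivation0 // !coefC (fun_if D).
by rewrite derivation0.
Qed.

Lemma derivation_polyXMn m : map_poly D ('X *+ m) = 0.
Proof.
have Dn k : D (k%:R) = 0.
  by elim: k => [|k IH]; rewrite ?derivation0 // mulrS Dadd derivation1 IH addr0.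
apply/polyP => h; rewrite coef_map_id0 ?derivation0 // coefMn coefX coef0.
by case: (h == 1%N); rewrite ?mul0rn ?derivation0.
Qed.

End Jacobi.

Section PoissonAlgebra.
Variables (K : fieldType) (n : nat).
Local Notation U := (coordmx K n).
Implicit Types f g h : glpoly K n.

Lemma mderiv_coordmx (i j p q : 'I_n) :
  (U i j)^`M(mxvec_index q p) = ((i == q) && (j == p))%:R.
Proof.
have := mderiv_coord (1 : K) p q i j.
by rewrite mpolyC1 !mulr1 mxE.
Qed.

(** The bracket as a bilinear form in the gradients. *)
Definition gradbr (A B : 'M[glpoly K n]_n) : glpoly K n :=
  \tr (U *m (A *m B - B *m A)).

Lemma kksE f g : kks f g = gradbr (gradmx f) (gradmx g).
Proof. by []. Qed.

Lemma gradbrC A B : gradbr A B = - gradbr B A.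
Proof. by rewrite /gradbr -(opprB (B *m A)) mulmxN linearN. Qed.

Lemma gradbr_suml (I : Type) (r : seq I) (F : I -> 'M_n) B :
  gradbr (\sum_(i <- r) F i) B = \sum_(i <- r) gradbr (F i) B.
Proof.
rewrite /gradbr -linear_sum /= -mulmx_sumr; congr (\tr (_ *m _)).
by rewrite mulmx_suml mulmx_sumr -sumrB.
Qed.

Lemma gradbrZl c A B : gradbr (c *: A) B = c * gradbr A B.
Proof. by rewrite /gradbr -scalemxAl -scalemxAr -scalerBr -scalemxAr linearZ. Qed.

Lemma gradbr_sumr (I : Type) (r : seq I) (F : I -> 'M_n) B :
  gradbr B (\sum_(i <- r) F i) = \sum_(i <- r) gradbr B (F i).
Proof. by rewrite gradbrC gradbr_suml -sumrN; apply: eq_bigr => i _; rewrite -gradbrC. Qed.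

Lemma gradbrZr c A B : gradbr B (c *: A) = c * gradbr B A.
Proof. by rewrite gradbrC gradbrZl -mulrN -gradbrC. Qed.

Lemma kksC f g : kks f g = - kks g f.
Proof. exact: gradbrC. Qed.

Lemma gradmxN f : gradmx (- f) = - gradmx f.
Proof. by apply/matrixP => i j; rewrite !mxE mderivN. Qed.

Lemma kks_signr (e : bool) f g : kks f ((-1) ^+ e * g) = (-1) ^+ e * kks f g.
Proof.
case: e; rewrite ?expr0 ?mul1r // expr1 !mulN1r !kksE gradmxN -scaleN1r gradbrZr.
by rewrite mulN1r.
Qed.

Lemma kks_signl (e : bool) f g : kks ((-1) ^+ e * f) g = (-1) ^+ e * kks f g.
Proof. by rewrite kksC kks_signr -mulrN -kksC. Qed.

Lemma gradmx_det m (M : 'M[glpoly K n]_m) :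
  gradmx (\det M) = \sum_i \sum_j cofactor M i j *: gradmx (M i j).
Proof.
apply/matrixP => p q; rewrite mxE (derivation_det (mderivD _) (mderivM _)) summxE.
apply: eq_bigr => i _; rewrite summxE; apply: eq_bigr => j _.
by rewrite !mxE.
Qed.

(** Expanding along a column with the cofactors of another one gives a determinant with a
    repeated column. *)
Lemma cofactor_alien m (M : 'M[glpoly K n]_m) (c c' : 'I_m) :
  \sum_r cofactor M r c * M r c' = (c == c')%:R * \det M.
Proof.
have /matrixP/(_ c c') := mul_adj_mx M; rewrite !mxE mulr_natl => <-.
by apply: eq_bigr => r _; rewrite mxE.
Qed.

Lemma gradmx_pow a (i j p q : 'I_n) :
  gradmx ((U ^+ a) i j) p q = \sum_(s < a) (U ^+ (a - s.+1)) p j * (U ^+ s) i q.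
Proof.
elim: a i => [|a IH] i.
  rewrite big_ord0 mxE expr0 -[1]/(1%:M) mxE.
  case: eqP => _; last by rewrite (derivation0 (mderivD _)).
  by rewrite (derivation1 (mderivM _)).
rewrite mxE exprS -[U * _]/(U *m _) mxE (derivation_sum (mderivD _)).
under eq_bigr => k _ do rewrite mderivM mderiv_coordmx.
rewrite big_split big_ord_recl /= subn1 /=; congr (_ + _).
  rewrite (bigD1 p) //= eqxx andbT big1 ?addr0 => [|k /negPf ->]; last first.
    by rewrite andbF mul0r.
  by rewrite expr0 -[1 : 'M__]/(1%:M) mxE mulrC.
transitivity (\sum_k U i k * \sum_(s < a) (U ^+ (a - s.+1)) p j * (U ^+ s) k q).
  by apply: eq_bigr => k _; rewrite -IH [gradmx _ _ _]mxE.
transitivity (\sum_k \sum_(s < a) U i k * ((U ^+ (a - s.+1)) p j * (U ^+ s) k q)).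
  by apply: eq_bigr => k _; rewrite mulr_sumr.
rewrite exchange_big /=; apply: eq_bigr => s _.
rewrite /bump add1n subSS exprS -[U * _]/(U *m _) mxE mulr_sumr.
by apply: eq_bigr => k _; ring.
Qed.

(** The gradient of [(u^a)_ij] is a sum of matrices of rank one, column [j] of
    [u^(a - 1 - s)] times row [i] of [u^s].  The bracket of two of them is a difference of
    products of two entries of powers of [u], and these differences telescope. *)
Lemma kks_pow (j : 'I_n) a b (i k : 'I_n) :
  let x i s := (U ^+ s) i j in
  kks (x i a) (x k b) =
  \sum_(s < a) (x i s * x k (a + b - s.+1)%N - x i (a + b - s.+1)%N * x k s).
Proof.
move=> x; pose T s := x i s * x k (a + b - s.+1)%N.
have gradE a' i' : gradmx (x i' a') =
    \sum_(s < a') col j (U ^+ (a' - s.+1)) *m row i' (U ^+ s).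
  apply/matrixP => p q; rewrite gradmx_pow summxE; apply: eq_bigr => s _.
  by rewrite !mxE big_ord1 !mxE.
have rank1 (c c' : 'cV[glpoly K n]_n) (r r' : 'rV[glpoly K n]_n) :
    gradbr (c *m r) (c' *m r') =
    (r *m c') ord0 ord0 * (r' *m U *m c) ord0 ord0 - (r' *m c) ord0 ord0 * (r *m U *m c') ord0 ord0.
  have tr11 (c0 : 'cV[glpoly K n]_n) (r0 : 'rV[glpoly K n]_n) (z : 'M_1) :
      \tr (c0 *m z *m r0) = z ord0 ord0 * (r0 *m c0) ord0 ord0.
    by rewrite mxtrace_mulC mulmxA /mxtrace big_ord1 mxE big_ord1 mulrC.
  rewrite /gradbr mulmxBr linearB /=; congr (_ - _).
    have -> : U *m (c *m r *m (c' *m r')) = (U *m c) *m (r *m c') *m r'.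
      by rewrite !mulmxA.
    by rewrite tr11 !mulmxA.
  have -> : U *m (c' *m r' *m (c *m r)) = (U *m c') *m (r' *m c) *m r.
    by rewrite !mulmxA.
  by rewrite tr11 !mulmxA.
have rowcol (i' : 'I_n) s t : (row i' (U ^+ s) *m col j (U ^+ t)) ord0 ord0 = x i' (s + t)%N.
  by rewrite /x exprD -[_ * _]/(_ *m _) !mxE; apply: eq_bigr => l _; rewrite !mxE.
have rowUcol (i' : 'I_n) s t : (row i' (U ^+ s) *m U *m col j (U ^+ t)) ord0 ord0 = x i' (s + t).+1.
  rewrite -row_mul -[U ^+ s *m U]/(U ^+ s * U) -exprSr rowcol.
  by congr (x _ _); lia.
rewrite kksE !gradE gradbr_suml.
transitivity (\sum_(s < a) (T s - T (s + b)%N)).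
  apply: eq_bigr => s _; rewrite gradbr_sumr.
  transitivity (\sum_(0 <= t < b) (T (s + t)%N - T (s + t.+1)%N)).
    rewrite big_nat_rev /= add0n big_mkord; apply: eq_bigr => t _.
    rewrite rank1 !rowcol !rowUcol /T.
    have sa := ltn_ord s; have tb := ltn_ord t.
    congr (x _ _ * x _ _ - _); try lia.
    by rewrite mulrC; congr (x _ _ * x _ _); lia.
  rewrite (eq_bigr (fun t => - T (s + t.+1)%N - - T (s + t)%N)) => [|t _]; last by ring.
  by rewrite (telescope_sumr (fun t => - T (s + t)%N)) // addn0 opprK addrC.
rewrite !sumrB; congr (_ - _).
rewrite (reindex_inj rev_ord_inj) /=; apply: eq_bigr => s _.
by rewrite /T; have sa := ltn_ord s; congr (x _ _ * x _ _); lia.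
Qed.

Definition flag_minor (j : 'I_n) m (I : 'I_m -> 'I_n) : glpoly K n :=
  \det (\matrix_(r, c < m) (U ^+ c.+1) (I r) j).

(** By Jacobi's formula and [kks_pow], the bracket is a combination of sums in which an entry
    of column [c] of [A] or [c'] of [B] has been replaced by that of another column.  For
    the replacement by a column [s < c] of [A], the cofactors of [A] give zero.  When
    column [c'] of [B] is replaced by column [s], only [s = c'] survives, and then the
    other factor replaces column [c] of [A] by column [c - 1].  The term of [kks_pow] with
    the power zero of [u] is absent because the rows avoid [j]. *)
Lemma kks_flag_minors_le (j : 'I_n) m l (I : 'I_m -> 'I_n) (J : 'I_l -> 'I_n) :
  (m <= l)%N -> (forall r, I r != j) -> (forall r, J r != j) ->
  kks (flag_minor j I) (flag_minor j J) = 0.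
Proof.
move=> ml Ij Jj.
have x0 (i : 'I_n) : i != j -> (U ^+ 0) i j = 0.
  by move=> ij; rewrite expr0 -[1]/(1%:M) mxE (negPf ij).
rewrite kksE /flag_minor !gradmx_det; set A := \matrix_(r, c < m) _; set B := \matrix_(r, c < l) _.
have bracket r c r' c' : gradbr (gradmx (A r c)) (gradmx (B r' c')) =
    \sum_(s < c) (A r (widen_ord (ltnW (ltn_ord c)) s) * (U ^+ (c + c' - s)%N) (J r') j -
                  (U ^+ (c + c' - s)%N) (I r) j * B r' (widen_ord (leq_trans (ltnW (ltn_ord c))
                    ml) s)).
  rewrite -kksE !mxE kks_pow big_ord_recl /= !x0 // mul0r mulr0 subr0 add0r.
  apply: eq_bigr => s _; rewrite !mxE /= /bump add1n.
  by congr (_ * (U ^+ _) _ _ - (U ^+ _) _ _ * _); lia.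
have key c c' : \sum_r \sum_r' cofactor A r c * (cofactor B r' c' *
    gradbr (gradmx (A r c)) (gradmx (B r' c'))) = 0.
  pose Y s r' := (U ^+ (c + c' - s)%N) (J r') j.
  pose Z s r := (U ^+ (c + c' - s)%N) (I r) j.
  pose sA := widen_ord (ltnW (ltn_ord c)).
  pose sB := widen_ord (leq_trans (ltnW (ltn_ord c)) ml).
  transitivity (\sum_(s < c)
      ((\sum_r cofactor A r c * A r (sA s)) * (\sum_r' cofactor B r' c' * Y s r') -
       (\sum_r cofactor A r c * Z s r) * (\sum_r' cofactor B r' c' * B r' (sB s)))).
    under [RHS]eq_bigr do rewrite !big_distrlr /= -sumrB.
    rewrite [RHS]exchange_big /=; apply: eq_bigr => r _.
    under [RHS]eq_bigr do rewrite -sumrB.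
    rewrite [RHS]exchange_big /=; apply: eq_bigr => r' _.
    rewrite bracket !mulr_sumr; apply: eq_bigr => s _.
    by rewrite -/(sA s) -/(sB s) -/(Y s r') -/(Z s r); ring.
  apply: big1 => s _; rewrite !cofactor_alien.
  rewrite (_ : (c == sA s) = false) ?mul0r ?sub0r; last first.
    by apply/negbTE; rewrite -val_eqE /= gtn_eqF.
  have [c's|_] := eqVneq c' (sB s); last by rewrite mul0r mulr0 oppr0.
  have c0 : (c.-1 < m)%N by apply: leq_ltn_trans (leq_pred _) (ltn_ord c).
  have -> : \sum_r cofactor A r c * Z s r = \sum_r cofactor A r c * A r (Ordinal c0).
    apply: eq_bigr => r _; rewrite mxE /Z c's /= addnK prednK //.
    exact: leq_ltn_trans (leq0n s) (ltn_ord s).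
  rewrite cofactor_alien (_ : (c == Ordinal c0) = false) ?mul0r ?oppr0 //.
  apply/negbTE; rewrite -val_eqE /= gtn_eqF // ltn_predL.
  exact: leq_ltn_trans (leq0n s) (ltn_ord s).
rewrite gradbr_suml.
under eq_bigr do rewrite gradbr_suml.
rewrite exchange_big /= big1 // => c _.
transitivity (\sum_c' \sum_r \sum_r' cofactor A r c * (cofactor B r' c' *
    gradbr (gradmx (A r c)) (gradmx (B r' c')))); last by apply: big1.
rewrite [RHS]exchange_big /=; apply: eq_bigr => r _.
rewrite [RHS]exchange_big /= gradbrZl gradbr_sumr mulr_sumr; apply: eq_bigr => r' _.
rewrite gradbr_sumr mulr_sumr; apply: eq_bigr => c' _.
by rewrite gradbrZr.
Qed.

Theorem kks_flag_minors (j : 'I_n) m l (I : 'I_m -> 'I_n) (J : 'I_l -> 'I_n) :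
  (forall r, I r != j) -> (forall r, J r != j) ->
  kks (flag_minor j I) (flag_minor j J) = 0.
Proof.
move=> Ij Jj; have [ml|/ltnW lm] := leqP m l; first exact: kks_flag_minors_le.
by rewrite kksC kks_flag_minors_le ?oppr0.
Qed.

Definition char_coef k : glpoly K n := (\det ('X%:M + map_mx polyC U))`_k.

(** The gradient of a coefficient of det(X + u) is a coefficient of the adjugate of
    X + u, which commutes with u. *)
Theorem kks_char_coef f k : kks f (char_coef k) = 0.
Proof.
pose M : 'M[{poly glpoly K n}]_n := 'X%:M + map_mx polyC U.
pose G : 'M[glpoly K n]_n := map_mx (coefp k) (\adj M).
have gradG : gradmx (char_coef k) = G.
  apply/matrixP => p q; rewrite mxE mxE /coefp /= mxE.
  pose D := mderiv (mxvec_index q p) : glpoly K n -> glpoly K n.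
  have dA x y : D (x + y) = D x + D y by exact: mderivD.
  have dM x y : D (x * y) = D x * y + x * D y by exact: mderivM.
  have dU i j : D (U i j) = ((i == q) && (j == p))%:R by exact: mderiv_coordmx.
  rewrite -[LHS]/(D (char_coef k)); clearbody D.
  have -> : D (char_coef k) = (map_poly D (\det M))`_k.
    by rewrite coef_map_id0 // (derivation0 dA).
  rewrite (derivation_det (derivation_polyD dA) (derivation_polyM dA dM)).
  have DMij i j : map_poly D (M i j) = ((i == q) && (j == p))%:R.
    rewrite mxE [('X%:M) i j]mxE [(map_mx _ _) i j]mxE (derivation_polyD dA).
    by rewrite (derivation_polyXMn dA dM) add0r (derivation_polyC dA) dU rmorph_nat.
  rewrite (bigD1 q) //= (bigD1 p) //= DMij !eqxx mulr1.
  rewrite big1 ?addr0 => [|j /negPf jp]; last by rewrite DMij jp andbF mulr0.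
  rewrite big1 ?addr0 // => i /negPf iq; apply: big1 => j _.
  by rewrite DMij iq mulr0.
have GU : G *m U = U *m G.
  have aM : \adj M *m map_mx polyC U = map_mx polyC U *m \adj M.
    have : \adj M *m M = M *m \adj M by rewrite mul_adj_mx mul_mx_adj.
    rewrite /M mulmxDr mulmxDl scalar_mxC => /addrI.
    exact.
  apply/matrixP => a b; have /matrixP/(_ a b) := aM; rewrite !mxE.
  move/(congr1 (coefp k)); rewrite /= !coef_sum => E.
  transitivity (\sum_j (\adj M a j * map_mx polyC U j b)`_k).
    by apply: eq_bigr => l _; rewrite !mxE coefMC.
  by rewrite E; apply: eq_bigr => l _; rewrite !mxE coefCM.
rewrite kksE gradG /gradbr mulmxBr linearB /= mulmxA mxtrace_mulC !mulmxA GU.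
by rewrite subrr.
Qed.

End PoissonAlgebra.

(** * Sums of principal minors as characteristic coefficients *)

Lemma det_mxsub_bij (R : comNzRingType) m n (h : 'I_m -> 'I_n) (A : 'M[R]_n) :
  m = n -> injective h -> \det (mxsub h h A) = \det A.
Proof.
move=> E; subst m => hinj; pose s := perm hinj.
have -> : mxsub h h A = row_perm s (col_perm s A).
  by apply/matrixP => i j; rewrite !mxE !permE.
rewrite row_permE col_permE !det_mulmx !det_perm odd_permV mulrCA.
by rewrite -signr_addb addbb mulr1.
Qed.

Section PrincipalMinors.
Variables (R : comNzRingType).

Variable n : nat.

(** Reordering the indices in this way makes [B J] below block triangular. *)
Definition set_first (J : {set 'I_n}) (k : 'I_(#|J| + #|~: J|)) : 'I_n :=
  match split k with inl a => enum_val a | inr b => enum_val b end.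

Lemma set_first_inj J : injective (@set_first J).
Proof.
move=> a b; rewrite /set_first -[a]splitK -[b]splitK !unsplitK.
case: (split a) => a'; case: (split b) => b' /= E.
- by rewrite (enum_val_inj E).
- by have := enum_valP b'; rewrite -E inE enum_valP.
- by have := enum_valP a'; rewrite E inE enum_valP.
- by rewrite (enum_val_inj E).
Qed.

(** Each row of [X + A] is a row of [X] plus a row of [A]; in the expansion, [J] is the set
    of the rows taken from [A]. *)
Lemma det_X_add (A : 'M[R]_n) :
  \det ('X%:M + map_mx polyC A) =
  \sum_(J : {set 'I_n})
     (\det (mxsub (@enum_val _ (mem J)) (@enum_val _ (mem J)) A))%:P * 'X^(n - #|J|).
Proof.
have cardJ (J : {set 'I_n}) : (#|J| + #|~: J| = n)%N by rewrite cardsC card_ord.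
pose B (J : {set 'I_n}) : 'M[{poly R}]_n :=
  \matrix_(i, j) if i \in J then (A i j)%:P else 'X *+ (i == j).
transitivity (\sum_(J : {set 'I_n}) \det (B J)).
  rewrite /determinant exchange_big /=; apply: eq_bigr => s _.
  rewrite -mulr_sumr; congr (_ * _).
  under eq_bigr => i _ do rewrite mxE addrC !mxE.
  rewrite bigA_distr; apply: eq_bigr => J _.
  by apply: eq_bigr => i _; rewrite mxE.
apply: eq_bigr => J _.
rewrite -(det_mxsub_bij (B J) (cardJ J) (@set_first_inj J)).
have -> : mxsub (@set_first J) (@set_first J) (B J) =
   block_mx (map_mx polyC (mxsub (@enum_val _ (mem J)) (@enum_val _ (mem J)) A))
     (\matrix_(a, b) (A (enum_val a) (enum_val b))%:P) 0 'X%:M.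
  apply/matrixP => a b; rewrite mxE -[a]splitK -[b]splitK /set_first !unsplitK.
  case: (split a) => a'; case: (split b) => b' /=;
    rewrite ?block_mxEul ?block_mxEur ?block_mxEdl ?block_mxEdr !mxE.
  - by rewrite enum_valP.
  - by rewrite enum_valP.
  - have := enum_valP a'; rewrite inE => /negbTE aJ; rewrite aJ.
    by case: eqP => // E; have := enum_valP b'; rewrite -E aJ.
  - have := enum_valP a'; rewrite inE => /negbTE ->.
    by rewrite (inj_eq enum_val_inj).
rewrite det_ublock det_map_mx det_scalar; congr (_ * 'X^_).
by have := cardJ J; lia.
Qed.

Lemma coef_det_X_add (A : 'M[R]_n) i : (i <= n)%N ->
  (\det ('X%:M + map_mx polyC A))`_i = sum_principal_minors A (n - i).
Proof.
move=> ile; rewrite det_X_add coef_sum /sum_principal_minors [RHS]big_mkcond.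
apply: eq_bigr => J _; rewrite coefCM coefXn.
have Jn : (#|J| <= n)%N by rewrite -[X in (_ <= X)%N](card_ord n) max_card.
have -> : (i == n - #|J|)%N = (#|J| == n - i)%N by apply/eqP/eqP; lia.
by case: eqP; rewrite ?mulr1 ?mulr0.
Qed.

End PrincipalMinors.

Lemma cbar_principal (F : fieldType) n (X Y : 'M[F]_n) i : (i <= n)%N ->
  cbar i X Y = sum_principal_minors (X *m invmx Y - 1%:M) (n - i).
Proof.
move=> ile; rewrite /cbar -coef_det_X_add //; congr (nth _ (polyseq (\det _)) _).
by apply/matrixP => a b; rewrite !mxE rmorphB rmorphMn /= rmorph1; ring.
Qed.

Lemma map_sum_principal_minors (R S : comNzRingType) (f : {rmorphism R -> S}) n
    (A : 'M[R]_n) k :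
  f (sum_principal_minors A k) = sum_principal_minors (map_mx f A) k.
Proof.
rewrite /sum_principal_minors rmorph_sum; apply: eq_bigr => J _.
by rewrite -det_map_mx map_mxsub.
Qed.

(** * Matrices with prescribed minors and characteristic polynomial *)

Section Realization.
Variable F : fieldType.

Let minor (G : nat -> nat -> F) (a m : nat) : F := \det (natmx m (fun s t => G (a + s)%N t)).

Let update (h : nat -> nat -> F) (m : nat) (z : F) (s t : nat) : F :=
  if (s == m) && (t == m) then z else h s t.

Lemma det_update (h : nat -> nat -> F) m z :
  \det (natmx m.+1 (update h m z)) = \det (natmx m.+1 (update h m 0)) + z * \det (natmx m h).
Proof.
have cof y j : cofactor (natmx m.+1 (update h m y)) ord_max j =
    cofactor (natmx m.+1 (update h m 0)) ord_max j.
  rewrite /cofactor; congr (_ * \det _); apply/matrixP => s t.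
  by rewrite !mxE lift_max /update ltn_eqF.
rewrite (expand_det_row _ ord_max) [in RHS](expand_det_row _ ord_max).
rewrite !big_ord_recr /= -addrA; congr (_ + _).
  apply: eq_bigr => j _; rewrite cof !mxE /update /=.
  by rewrite [_ == m in LHS]eqxx (ltn_eqF (ltn_ord j)) eqxx.
rewrite cof !mxE /update /= eqxx /= mul0r add0r; congr (_ * _).
rewrite /cofactor /= -signr_odd addnn odd_double expr0 mul1r; congr (\det _).
apply/matrixP => s t.
by rewrite !mxE !lift_max /update ltn_eqF.
Qed.

(** The minors on initial columns and consecutive rows can be prescribed: the last entry
    of such a minor has as coefficient a minor already chosen to be nonzero. *)
Lemma realize_minors n (d : nat -> nat -> F) : (forall a m, d a m != 0) ->
  exists G : nat -> nat -> F, forall m a, (0 < m)%N -> (a + m <= n)%N -> minor G a m = d a m.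
Proof.
move=> d0.
suff [G HG] : exists G : nat -> nat -> F, forall m a,
    (0 < m <= n)%N -> (a + m <= n)%N -> minor G a m = d a m.
  by exists G => m a m0 amn; apply: HG => //; lia.
elim: {1}n => [|M [G HG]]; first by exists (fun _ _ => 0) => m a; lia.
have G0 a : (a + M <= n)%N -> minor G a M != 0.
  case: (posnP M) => [->|M0] aM; first by rewrite /minor det_mx00 oner_eq0.
  by rewrite HG // M0 leqnn.
(* Column M is filled from the top: the first M entries are arbitrary, and the entry in a
   row B >= M is determined by the minor on the rows B - M, ..., B. *)
pose ext (g : nat -> F) s t := if t == M then g s else G s t.
suff [g Hg] : exists g : nat -> F, forall a, (a + M.+1 <= n)%N -> minor (ext g) a M.+1 = d a M.+1.
  exists (ext g) => m a mM amn.
  have [mE|mN] := eqVneq m M.+1; first by rewrite mE Hg // -mE.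
  rewrite -HG //; last by lia.
  congr (\det _); apply/matrixP => s t; rewrite !mxE /ext ltn_eqF //.
  by have := ltn_ord t; lia.
suff H B : exists g : nat -> F, forall a, (a + M.+1 <= B)%N -> (a + M.+1 <= n)%N ->
    minor (ext g) a M.+1 = d a M.+1.
  by have [g Hg] := H n; exists g => a an; apply: Hg.
elim: B => [|B [g Hg]]; first by exists (fun _ => 0) => a; lia.
have [BM|MB] := ltnP B M; first by exists g => a; lia.
pose a0 := (B - M)%N.
pose h s t := ext g (a0 + s)%N t.
pose z := (d a0 M.+1 - \det (natmx M.+1 (update h M 0))) / minor G a0 M.
exists (fun b => if b == B then z else g b) => a aB an.
have [aE|aN] := eqVneq a a0; last first.
  rewrite -Hg //; last by rewrite /a0 in aN; lia.
  congr (\det _); apply/matrixP => s t; rewrite !mxE /ext.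
  by case: (_ == M) => //; rewrite ifN //; have := ltn_ord s; rewrite /a0 in aN; lia.
have -> : minor (ext (fun b => if b == B then z else g b)) a M.+1 =
  \det (natmx M.+1 (update h M z)).
  congr (\det _); apply/matrixP => s t; rewrite !mxE /update /h /ext aE.
  rewrite (_ : (a0 + s == B)%N = (s == M :> nat)); last by apply/eqP/eqP; rewrite /a0; lia.
  by case: (_ == M); case: (_ == M).
rewrite det_update (_ : \det (natmx M h) = minor G a0 M); last first.
  by congr (\det _); apply/matrixP => s t; rewrite !mxE /h /ext ltn_eqF.
rewrite /z divfK ?G0 //; last by rewrite -aE; lia.
by rewrite aE addrC subrK.
Qed.

(** The size of [companionmx p] is [(size p).-1], which is equal to [n.+1] but not
    convertible to it. *)
Lemma companion_exists n (p : {poly F}) : p \is monic -> size p = n.+2 ->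
  exists2 C : 'M[F]_n.+1, char_poly C = p &
    forall i j : 'I_n.+1, (i < n)%N -> C i j = (i.+1 == j :> nat)%:R.
Proof.
move=> pm sp; have E : (size p).-1 = n.+1 by rewrite sp.
have rows : forall i j : 'I_(size p).-1, (i < n)%N -> companionmx p i j = (i.+1 == j :> nat)%:R.
  move=> i j ip; rewrite mxE ifN //.
  by apply: contraTneq ip => ->; rewrite E ltnn.
move: (companionmxK pm) rows; move: (companionmx p).
by rewrite E => C HC HR; exists C.
Qed.

(** Take [u = g C g^-1] with [C] the transpose of a companion matrix, so that
    [C e_j = e_(j + 1)], and [g] fixing [e_1].  Then [u^k e_1 = g e_(k + 1)]: the minors of
    [Fmx u] are those of [g], and the sums of principal minors are those of [C]. *)
Theorem realize_system n (d : nat -> nat -> F) (c : nat -> F) :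
  (0 < n)%N -> (forall p i, d p i != 0) ->
  exists u : 'M[F]_n.+1,
    (forall p i, (p < n)%N -> (i <= p)%N ->
      Delta (Fmx u) i.+2 (n.+1 - p + i.+1 - 1) 1 = d p i) /\
    (forall i, (i <= n)%N -> sum_principal_minors u (n.+1 - i) = c i).
Proof.
move=> n0 d0.
have [G HG] := @realize_minors n (fun a m => d (n - m)%N a) (fun a m => d0 _ _).
(* The characteristic polynomial of u is det (X - u), hence the signs. *)
pose q : {poly F} := \poly_(i < n.+1) ((-1) ^+ (n.+1 - i) * c i).
pose p : {poly F} := 'X^(n.+1) + q.
have szq : (size q < size ('X^(n.+1) : {poly F}))%N.
  by rewrite size_polyXn ltnS size_poly.
have sp : size p = n.+2 by rewrite /p size_polyDl // size_polyXn.
have pm : p \is monic by rewrite monicE /p lead_coefDl // lead_coefXn.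
have [C HC Crow] := companion_exists pm sp.
pose g : 'M[F]_(1 + n) := block_mx 1%:M 0 0 (natmx n G).
have gu : (g : 'M_n.+1) \in unitmx.
  have dg : \det (g : 'M[F]_(1 + n)) = minor G 0 n.
    exact: etrans (det_ublock _ _ _) (etrans (congr1 (fun x => x * _) (det1 _ _)) (mul1r _)).
  by rewrite unitmxE unitfE [X in X != 0]dg HG.
pose u : 'M[F]_n.+1 := g *m C^T *m invmx g.
pose ev j : 'cV[F]_n.+1 := \col_h (h == j :> nat)%:R.
have CT j : (j < n)%N -> C^T *m ev j = ev j.+1.
  move=> jn; apply/matrixP => h z; rewrite [z]ord1 !mxE.
  have jn' : (j < n.+1)%N by lia.
  rewrite (bigD1 (Ordinal jn')) //= big1 ?addr0 => [|k kj].
    by rewrite !mxE Crow //= eqxx mulr1 eq_sym.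
  by rewrite !mxE (_ : (k == j :> nat) = false) ?mulr0 //; apply: contraNF kj => /eqP kj;
    apply/eqP/val_inj.
have g0 : g *m ev 0%N = ev 0%N.
  apply/matrixP => h z; rewrite [z]ord1 mxE (bigD1 ord0) //= big1 ?addr0 => [|k k0].
    have e00 : ev 0%N ord0 0 = 1 by rewrite mxE.
    rewrite e00 mulr1 [RHS]mxE; have -> : ord0 = lshift n (ord0 : 'I_1) by apply: val_inj.
    rewrite -[h]splitK; case: (split h) => h' /=.
      by rewrite block_mxEul mxE [h']ord1.
    by rewrite block_mxEdl mxE.
  by rewrite [ev _ _ _]mxE (_ : (k == 0%N :> nat) = false) ?mulr0 //;
    apply: contraNF k0 => /eqP k0; apply/eqP/val_inj.
have uk k : (k <= n)%N -> u ^+ k *m ev 0%N = g *m ev k.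
  elim: k => [|k IH] kn; first by rewrite expr0 mul1mx g0.
  rewrite exprS -[u * _]/(u *m _) -mulmxA IH ?(ltnW kn) // /u -!mulmxA mulKmx // CT //.
exists u; split=> [p' i pn ip|i ile].
  rewrite Delta_Fmx // -[d p' i]/(d p' i).
  have -> : d p' i = minor G i (n - p')%N by rewrite HG ?subKn //; lia.
  congr (\det _); apply/matrixP => a b; rewrite [LHS]mxE [RHS]mxE.
  have bn : (b < n)%N by have := ltn_ord b; lia.
  have an : (i + a < n)%N by have := ltn_ord a; lia.
  rewrite -/(ev 0%N) uk // mxE (bigD1 (rshift 1 (Ordinal bn))) //= big1 ?addr0 => [|k kb].
    have -> : inord (i.+1 + a) = rshift 1 (Ordinal an) :> 'I_n.+1.
      by apply: val_inj; rewrite /= inordK // ; lia.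
    by rewrite block_mxEdr !mxE eqxx mulr1.
  rewrite [ev _ _ _]mxE (_ : (k == b.+1 :> nat) = false) ?mulr0 //.
  by apply: contraNF kb => /eqP kb; apply/eqP/val_inj.
have ile1 : (i <= n.+1)%N by rewrite ltnW.
have chN : \det ('X%:M + map_mx polyC (- u)) = p.
  rewrite -HC /char_poly /char_poly_mx -[in RHS]det_tr.
  have -> : ('X%:M - map_mx polyC C)^T = 'X%:M - map_mx polyC C^T.
    by rewrite linearB /= tr_scalar_mx map_trmx.
  have gg : map_mx polyC g *m map_mx polyC (invmx g) = 1%:M :> 'M[{poly F}]_n.+1.
    by rewrite -map_mxM mulmxV // map_mx1.
  have -> : 'X%:M + map_mx polyC (- u) =
     map_mx polyC g *m ('X%:M - map_mx polyC C^T) *m map_mx polyC (invmx g).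
    have gXg : map_mx polyC g *m 'X%:M *m map_mx polyC (invmx g) = 'X%:M.
      by rewrite scalar_mxC -mulmxA gg mulmx1.
    by rewrite mulmxBr mulmxBl gXg map_mxN /u !map_mxM.
  rewrite !det_mulmx mulrAC -det_mulmx gg det1 mul1r.
  by [].
have spmN k : sum_principal_minors (- u) k = (-1) ^+ k * sum_principal_minors u k.
  rewrite /sum_principal_minors mulr_sumr; apply: eq_bigr => J /eqP <-.
  by rewrite -detZ scaleN1r; congr (\det _); apply/matrixP => a b; rewrite !mxE.
have := coef_det_X_add (- u) ile1; rewrite chN spmN /p coefD coefXn ltn_eqF ?ltnS // add0r.
rewrite coef_poly ltnS ile => /esym E.
by apply: (@mulfI _ ((-1) ^+ (n.+1 - i))); rewrite ?signr_eq0.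
Qed.

End Realization.

(** * The rank of the Poisson structure *)

Section Rank.
Variable K : numFieldType.

Lemma rank_of_minor m n r (A : 'M[K]_(m, n)) (f : 'I_r -> 'I_m) (g : 'I_r -> 'I_n) :
  \det (mxsub f g A) != 0 -> (r <= \rank A)%N.
Proof.
rewrite -unitfE -unitmxE => /mxrank_unit <-.
have -> : mxsub f g A = rowsub f 1%:M *m A *m colsub g 1%:M.
  by rewrite mul_rowsub_mx mul1mx mulmx_colsub mulmx1; apply/matrixP => i j; rewrite !mxE.
exact: leq_trans (mxrankM_maxl _ _) (mxrankM_maxr _ _).
Qed.

Lemma minor_of_rank m n (A : 'M[K]_(m, n)) :
  exists (f : 'I_(\rank A) -> 'I_m) (g : 'I_(\rank A) -> 'I_n), \det (mxsub f g A) != 0.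
Proof.
pose f := maxrankfun A; pose A1 := rowsub f A.
have A1f : row_full A1^T by rewrite /row_full mxrank_tr; exact: maxrowsub_free.
pose g := fullrankfun A1f; exists f, g.
have := fullrowsub_unit A1f; rewrite -unitmx_tr unitmxE unitfE.
by congr (\det _ != 0); apply/matrixP => i j; rewrite !mxE.
Qed.

Variable n : nat.
Local Notation N := n.+1.
Local Notation U := (coordmx K N).

Definition kks_mx (u : 'M[K]_N) : 'M[K]_(N * N) :=
  \matrix_(k, l) gleval (kks 'X_k 'X_l) u.

Lemma kks_coord (i j k l : 'I_N) :
  kks (U i j) (U k l) = (i == l)%:R * U k j - (k == j)%:R * U i l.
Proof.
have gradU a b : gradmx (U a b) = delta_mx b a.
  by apply/matrixP => p q; rewrite mxE mderiv_coordmx mxE andbC [a == q]eq_sym [b == p]eq_sym.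
rewrite kksE /gradbr !gradU !mul_delta_mx_cond mulmxBr linearB /=.
have tr_delta (b : bool) (a c : 'I_N) : \tr (U *m (delta_mx a c *+ b)) = b%:R * U c a.
  case: b; last by rewrite mulr0n mulmx0 mxtrace0 mul0r.
  rewrite mulr1n mul1r mxtrace_mulC; rewrite /mxtrace (bigD1 a) //= big1 ?addr0 => [|h ha].
    rewrite mxE (bigD1 c) //= big1 ?addr0 => [|h hc];
      first by rewrite [delta_mx _ _ _ _]mxE !eqxx mul1r.
    by rewrite [delta_mx _ _ _ _]mxE (negPf hc) andbF mul0r.
  by rewrite mxE big1 // => h' _; rewrite [delta_mx _ _ _ _]mxE (negPf ha) mul0r.
by rewrite !tr_delta.
Qed.

Lemma kks_mxE (u : 'M[K]_N) (i j k l : 'I_N) :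
  kks_mx u (mxvec_index i j) (mxvec_index k l) =
  (i == l)%:R * u k j - (k == j)%:R * u i l.
Proof.
have XE a b : 'X_(mxvec_index a b) = U a b by rewrite mxE.
have glB p q : gleval (p - q) u = gleval p u - gleval q u by exact: rmorphB.
have glM (b : bool) p : gleval (b%:R * p) u = b%:R * gleval p u.
  by rewrite glevalM /gleval rmorph_nat.
by rewrite mxE !XE kks_coord glB !glM !gleval_coordmx.
Qed.

(** At a diagonal matrix with distinct entries, the coordinates off the diagonal form
    dual pairs. *)
Lemma kks_rank_generic : exists u : 'M[K]_N, (N * N - N <= \rank (kks_mx u))%N.
Proof.
pose u : 'M[K]_N := \matrix_(i, j) (if i == j then i%:R else 0).
pose O : {set 'I_N * 'I_N} := finset (fun ij : 'I_N * 'I_N => ij.1 != ij.2).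
have cardO : #|O| = (N * N - N)%N.
  have := cardsC O; rewrite card_prod card_ord.
  have -> : (~: O = (fun i : 'I_N => (i, i)) @: finset.setT)%SET.
    apply/setP => -[i j]; rewrite !inE negbK /=; apply/eqP/imsetP => [<-|[k _ [-> ->]] //].
    by exists i.
  rewrite card_imset => [|i j [] //]; rewrite cardsT card_ord => <-.
  by rewrite addnK.
exists u; rewrite -cardO.
pose e (a : 'I_#|O|) := enum_val a.
apply: (@rank_of_minor _ _ _ _ (fun a => mxvec_index (e a).1 (e a).2)
                               (fun a => mxvec_index (e a).2 (e a).1)).
have -> : mxsub (fun a => mxvec_index (e a).1 (e a).2) (fun a =>
  mxvec_index (e a).2 (e a).1) (kks_mx u)
   = diag_mx (\row_a ((e a).2%:R - (e a).1%:R)).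
  apply/matrixP => a b; rewrite mxE kks_mxE !mxE.
  have [->|ab] := eqVneq a b; first by rewrite !eqxx mulr1n !mul1r.
  have : (e a).1 == (e b).1 -> (e b).2 == (e a).2 -> False.
    move=> /eqP E1 /eqP E2; case/eqP: ab; apply: enum_val_inj.
    by rewrite -/(e a) -/(e b) [e a]surjective_pairing [e b]surjective_pairing E1 E2.
  case: eqP => E1; case: eqP => E2; rewrite ?mul0r ?mul1r ?subr0 //.
  by move=> /(_ isT isT).
rewrite det_diag; apply/prodf_neq0 => a _; rewrite mxE subr_eq0.
have := enum_valP a; rewrite inE -/(e a) => ne.
by rewrite eqr_nat; apply: contraNneq ne => E; apply/eqP/val_inj.
Qed.

Definition krylov (S : comNzRingType) (u : 'M[S]_N) : 'M[S]_N :=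
  \matrix_(s, i) (u ^+ s) i ord0.

Lemma sum_mxvec (V : nmodType) m p (f : 'I_(m * p) -> V) :
  \sum_k f k = \sum_i \sum_j f (mxvec_index i j).
Proof.
rewrite pair_bigA /= (reindex (uncurry (@mxvec_index m p))) /=; last exact: curry_mxvec_bij.
by apply: eq_bigr => -[i j].
Qed.

(** The powers of u lie in the kernel of the Poisson tensor at u. *)
Lemma kks_rank_cyclic (u : 'M[K]_N) :
  \det (krylov u) != 0 -> (\rank (kks_mx u) <= N * N - N)%N.
Proof.
move=> ku.
pose P : 'M[K]_(N, N * N) := \matrix_(s, k) mxvec (u ^+ s)^T 0 k.
have PK : P *m kks_mx u = 0.
  apply/matrixP => s k; rewrite [RHS]mxE mxE.
  case/mxvec_indexP: k => k l.
  have -> : \sum_h P s h * kks_mx u h (mxvec_index k l) =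
      \sum_j u k j * (u ^+ s) j l - \sum_i (u ^+ s) k i * u i l.
    rewrite sum_mxvec.
    transitivity (\sum_i \sum_j ((i == l)%:R * (u k j * (u ^+ s) j i) -
                                (k == j)%:R * ((u ^+ s) j i * u i l))).
      apply: eq_bigr => i _; apply: eq_bigr => j _.
      by rewrite mxE mxvecE mxE kks_mxE; ring.
    under eq_bigr do rewrite sumrB.
    rewrite sumrB; congr (_ - _).
      rewrite (bigD1 l) //= [X in _ + X]big1 ?addr0 => [|i /negPf il]; last first.
        by rewrite big1 // => j _; rewrite il mul0r.
      by apply: eq_bigr => j _; rewrite eqxx mul1r.
    apply: eq_bigr => i _; rewrite (bigD1 k) //= eqxx mul1r big1 ?addr0 // => j /negPf jk.
    by rewrite eq_sym jk mul0r.
  have -> : \sum_j u k j * (u ^+ s) j l = (u ^+ s.+1) k l by rewrite exprS mxE.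
  by rewrite exprSr [X in X - _]mxE subrr.
have rP : \rank P = N.
  apply/eqP; rewrite eqn_leq rank_leq_row /=.
  pose Q : 'M[K]_(N * N, N) := \matrix_(k, i) (k == mxvec_index ord0 i)%:R.
  have PQ : P *m Q = krylov u.
    apply/matrixP => s i; rewrite !mxE (bigD1 (mxvec_index ord0 i)) //= big1 ?addr0.
      by rewrite !mxE eqxx mulr1 mxvecE mxE.
    by move=> k /negPf ki; rewrite !mxE ki mulr0.
  have ku' : krylov u \in unitmx by rewrite unitmxE unitfE.
  by rewrite -[X in (X <= _)%N](mxrank_unit ku') -PQ mxrankM_maxl.
by have := mulmx0_rank_max PK; rewrite rP; lia.
Qed.

(** The shift matrix has the first basis vector as a cyclic vector. *)
Lemma krylov_generic : exists u : 'M[K]_N, \det (krylov u) != 0.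
Proof.
pose u : 'M[K]_N := \matrix_(i, j) (i == j.+1 :> nat)%:R; exists u.
have uk s i : (s < N)%N -> (u ^+ s) i ord0 = (i == s :> nat)%:R.
  elim: s i => [|s IH] i sN; first by rewrite expr0 -[1]/(1%:M) mxE.
  rewrite exprS mxE (bigD1 (Ordinal (ltnW sN))) //= big1 ?addr0 => [|j js].
    by rewrite mxE IH ?(ltnW sN) // eqxx mulr1.
  rewrite IH ?(ltnW sN) // (_ : (j == s :> nat) = false) ?mulr0 //.
  by apply: contraNF js => /eqP js; apply/eqP/val_inj.
have -> : krylov u = 1%:M by apply/matrixP => s i; rewrite !mxE uk // eq_sym.
by rewrite det1 oner_eq0.
Qed.

(** Since a nonzero minor of the Poisson tensor stays nonzero nearby, it is enough to bound
    the rank at the points with a cyclic vector. *)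
Lemma kks_rank_le (u : 'M[K]_N) : (\rank (kks_mx u) <= N * N - N)%N.
Proof.
have [f [g fg]] := minor_of_rank (kks_mx u).
pose PiU : 'M[glpoly K N]_(N * N) := \matrix_(k, l) kks 'X_k 'X_l.
have detE m (M : 'M[glpoly K N]_m) v : gleval (\det M) v = \det (map_mx (fun p => gleval p v) M).
  by rewrite /gleval -det_map_mx.
pose p1 := \det (mxsub f g PiU); pose p2 := \det (krylov U).
have p1E v : gleval p1 v = \det (mxsub f g (kks_mx v)).
  by rewrite detE; congr (\det _); apply/matrixP => i j; rewrite !mxE.
have p2E v : gleval p2 v = \det (krylov v).
  rewrite detE; congr (\det _); apply/matrixP => i j; rewrite !mxE.
  apply: (@gleval_mx_pow K N id U); exists (const_mx 1) => a b; rewrite !mxE ?normr1 //.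
  by rewrite mpolyC1 mul1r; split=> // w; rewrite mul1r.
have p10 : p1 != 0 by apply: contraNneq fg => p10; rewrite -p1E p10 gleval0.
have p20 : p2 != 0.
  by have [v] := krylov_generic; rewrite -p2E; apply: contraNneq => ->; rewrite gleval0.
have [v _] := mpoly_nonvanishing (mulf_neq0 p10 p20).
have <- : gleval (p1 * p2) (vec_mx (\row_k v k)) = (p1 * p2).@[v].
  by rewrite /gleval vec_mxK; apply: meval_eq => k; rewrite mxE.
rewrite glevalM mulf_eq0 negb_or p1E p2E => /andP[/rank_of_minor h1 /kks_rank_cyclic h2].
exact: leq_trans h1 h2.
Qed.

Theorem kks_rank_eq : kks_rank K N = (N * N - N)%N.
Proof.
apply/eqP; rewrite eqn_leq /kks_rank; apply/andP; split.
  by apply/bigmax_leqP => r /asboolP[u <-]; exact: kks_rank_le.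
have [u hu] := kks_rank_generic.
have ru : (\rank (kks_mx u) < (N * N).+1)%N by rewrite ltnS rank_leq_row.
apply: leq_trans hu _.
have := @leq_bigmax_cond _ (fun r : 'I_(N * N).+1 => `[< exists v, \rank (kks_mx v) = r >])
  (fun r => r : nat) (Ordinal ru).
by apply; apply/asboolP; exists u.
Qed.

End Rank.

(** * Lowest terms and the integrable system *)

Section LowestTerms.
Variable K : numFieldType.
Hypothesis pow2_dominates : forall c e : K, 0 <= c -> 0 < e ->
  exists N, forall m, (N <= m)%N -> c <= e * 2 ^+ m.
Hypothesis geometric_sums : forall a : nat -> K,
  (forall k, `|a k| <= 4^-1 ^+ k) -> exists s, wsum a s.
Variable n : nat.
Local Notation N := n.+1.
Local Notation U := (coordmx K N).

Lemma krylov_entry (S : comNzRingType) (A : 'M[S]_N) (h : 'I_N) :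
  (A *m (\col_j (j == 0 :> nat)%:R : 'cV[S]_N)) h ord0 = A h ord0.
Proof.
rewrite mxE (bigD1 ord0) //= big1 ?addr0 => [|j j0]; first by rewrite mxE mulr1.
rewrite mxE (_ : (j == 0%N :> nat) = false) ?mulr0 //.
by apply: contraNF j0 => /eqP j0; apply/eqP/val_inj.
Qed.

Lemma Delta_FmxE (S : comNzRingType) (p i : nat) (W : 'M[S]_N) :
  (p < n)%N -> (i <= p)%N ->
  Delta (Fmx W) i.+2 (N - p + i.+1 - 1) 1 =
  \det (natmx (n - p) (fun a j => (W ^+ j.+1) (inord (i.+1 + a)) ord0)).
Proof.
move=> pn ip; rewrite Delta_Fmx //; congr (\det _); apply/matrixP => a b.
by rewrite [LHS]mxE [RHS]mxE krylov_entry.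
Qed.

Definition flag_poly (p i : nat) : glpoly K N := Delta (Fmx U) i.+2 (N - p + i.+1 - 1) 1.

Lemma flag_polyE p i : (p < n)%N -> (i <= p)%N ->
  flag_poly p i = flag_minor K ord0 (fun a : 'I_(n - p) => inord (i.+1 + a)).
Proof. exact: Delta_FmxE. Qed.

Lemma gleval_det m (M : 'M[glpoly K N]_m) u :
  gleval (\det M) u = \det (map_mx (fun p => gleval p u) M).
Proof. by rewrite /gleval -det_map_mx. Qed.

Lemma gleval_coord_pow k i j u : gleval ((U ^+ k) i j) u = (u ^+ k) i j.
Proof.
apply: (@gleval_mx_pow K N id U); exists (const_mx 1) => a b; rewrite !mxE ?normr1 //.
by rewrite mpolyC1 mul1r; split=> // w; rewrite mul1r.
Qed.

Lemma gleval_flag_poly p i u : (p < n)%N -> (i <= p)%N ->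
  gleval (flag_poly p i) u = Delta (Fmx u) i.+2 (N - p + i.+1 - 1) 1.
Proof.
move=> pn ip; rewrite /flag_poly !Delta_FmxE // gleval_det; congr (\det _).
by apply/matrixP => a b; rewrite !mxE gleval_coord_pow.
Qed.

Lemma gleval_principal k u :
  gleval (sum_principal_minors U k) u = sum_principal_minors u k.
Proof.
rewrite /gleval map_sum_principal_minors; congr sum_principal_minors.
by apply/matrixP => i j; rewrite mxE; exact: gleval_coordmx.
Qed.

Lemma Delta_FmxN (S : comNzRingType) (p i : nat) (W : 'M[S]_N) :
  (p < n)%N -> (i <= p)%N ->
  Delta (Fmx (- W)) i.+2 (N - p + i.+1 - 1) 1 =
  (-1) ^+ odd (\sum_(j < n - p) j.+1) * Delta (Fmx W) i.+2 (N - p + i.+1 - 1) 1.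
Proof.
move=> pn ip; rewrite !Delta_FmxE //.
pose D (j b : nat) : S := if j == b then (-1) ^+ b.+1 else 0.
have <- : \det (natmx (n - p) D) = (-1) ^+ odd (\sum_(j < n - p) j.+1).
  rewrite (@det_natmx_upper _ _ D) => [|a b /andP[ba _]]; last by rewrite /D gtn_eqF.
  rewrite signr_odd (big_morph (fun k => (-1) ^+ k) (exprD _) (expr0 _)).
  by apply: eq_bigr => b _; rewrite /D eqxx.
rewrite mulrC -det_mulmx; congr (\det _); apply/matrixP => a b.
rewrite [LHS]mxE [RHS]mxE (bigD1 b) //= big1 ?addr0 => [|j jb]; last first.
  by rewrite !mxE /D (_ : (j == b :> nat) = false) ?mulr0 // val_eqE (negPf jb).
rewrite -[- W]scaleN1r exprZn [in LHS]mxE mulrC; congr (_ * _); first by rewrite mxE.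
by rewrite mxE /D eqxx.
Qed.

(** The entries in column [j] of the minor are entries of [W^(j + 1)]. *)
Lemma has_exp_Delta_Fmx (W : 'M[K]_N -> 'M[K]_N) (L : 'M[glpoly K N]_N) p i :
  (p < n)%N -> (i <= p)%N ->
  (forall a b, has_exp (fun u => W u a b) 1 (L a b)) ->
  has_exp (fun u => Delta (Fmx (W u)) i.+2 (N - p + i.+1 - 1) 1)
    (\sum_(j < n - p) j.+1) (Delta (Fmx L) i.+2 (N - p + i.+1 - 1) 1).
Proof.
move=> pn ip WL; rewrite Delta_FmxE //.
pose M (a j : 'I_(n - p)) (u : 'M[K]_N) := (W u ^+ j.+1) (inord (i.+1 + a)) ord0.
apply: (@has_exp_ext _ _ (fun u => \det (\matrix_(a, j) M a j u))).
  by move=> u; rewrite Delta_FmxE.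
apply: (@has_exp_det _ _ _ M (fun j => j.+1)) => a j.
rewrite mxE; exact: has_exp_mx_pow.
Qed.

Lemma has_exp_principal (W : 'M[K]_N -> 'M[K]_N) (L : 'M[glpoly K N]_N) k :
  (forall a b, has_exp (fun u => W u a b) 1 (L a b)) ->
  has_exp (fun u => sum_principal_minors (W u) k) k (sum_principal_minors L k).
Proof.
move=> WL; rewrite /sum_principal_minors; apply: has_exp_sum => J /eqP Jk.
have -> : k = (\sum_(j < #|J|) 1)%N by rewrite sum1_card card_ord.
pose M (a b : 'I_#|J|) (u : 'M[K]_N) : K := W u (enum_val a) (enum_val b).
apply: (@has_exp_ext _ _ (fun u => \det (\matrix_(a, b) M a b u))).
  by move=> u; congr (\det _); apply/matrixP => a b; rewrite !mxE.
by apply: (@has_exp_det _ _ _ M (fun=> 1%N)) => a b; rewrite mxE; exact: WL.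
Qed.

Lemma flag_poly_neq0 p i : (p < n)%N -> (i <= p)%N -> flag_poly p i != 0.
Proof.
move=> pn ip; have n0 : (0 < n)%N by apply: leq_ltn_trans pn.
have [u [Hu _]] := @realize_system K n (fun _ _ => 1) (fun _ => 0) n0 (fun _ _ => oner_neq0 _).
by apply: contraTneq (oner_neq0 K) => E; rewrite -(Hu p i) // -gleval_flag_poly // E gleval0 eqxx.
Qed.

Lemma principal_neq0 i : (0 < n)%N -> (i <= n)%N -> sum_principal_minors U (N - i) != 0.
Proof.
move=> n0 ile.
have [u [_ Hu]] := @realize_system K n (fun _ _ => 1) (fun _ => 1) n0 (fun _ _ => oner_neq0 _).
by apply: contraTneq (oner_neq0 K) => E; rewrite -(Hu i) // -gleval_principal E gleval0 eqxx.
Qed.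

Lemma expmx_unit (x : 'M[K]_N) : (forall i j, `|x i j| <= (4 * N%:R)^-1) ->
  expmx x \in unitmx /\ invmx (expmx x) = expmx (- x).
Proof.
move=> xs; have E := expmxN pow2_dominates geometric_sums xs.
have xu : expmx x \in unitmx by case/mulmx1_unit: E.
by split=> //; rewrite -[RHS](mulKmx xu) E mulmx1.
Qed.

(** The product of diagonal entries of [X] has the constant term 1, so that the lowest term
    is that of the minor of [Fmx (X^-1 Y - 1)], with [X^-1 Y - 1 = - u + ...]. *)
Theorem low_phi p i : (p < n)%N -> (i <= p)%N ->
  exists e : bool, low (phi (n := N) (p * n + i).+1) = (-1) ^+ e * flag_poly p i.
Proof.
move=> pn ip; have [e [r phiE]] := phi_factorization K pn ip.
pose e' := odd (\sum_(j < n - p) j.+1); exists (e (+) e').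
apply: (low_eq pow2_dominates (d := \sum_(j < n - p) j.+1)); last first.
  by rewrite mulf_neq0 ?signr_eq0 // flag_poly_neq0.
pose W u := expmx (- gst_upper u) *m expmx (gst_upper u - u) - 1%:M : 'M[K]_N.
have diag j : has_exp (fun u : 'M[K]_N => expmx (gst_upper u) j j) 0 1.
  have h := has_exp_expmx pow2_dominates geometric_sums (@gst_upper_scaled K N) j j.
  have := has_exp_add (has_exp_weaken (ltn0Sn 0) h) (has_exp_const N 1).
  rewrite add0r mpolyC1; apply: has_exp_ext => u.
  by rewrite !mxE eqxx subrK.
have prod_diag := has_exp_prod r diag.
rewrite big1 // big1 // in prod_diag.
have := has_exp_mul (has_exp_scale ((-1) ^+ e) prod_diag)
  (has_exp_Delta_Fmx pn ip (has_exp_dual_quotient pow2_dominates geometric_sums (n := N))).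
rewrite add0n mulr1 Delta_FmxN // mulrA rmorphXn rmorphN rmorph1 -signr_addb.
apply: has_exp_near; apply: near0S (near0_small K N) => u us.
have gs := scaled_entries_small (@gst_upper_scaled K N) us.
have [Xu Xi] := expmx_unit gs.
have [gt _ _] := gst_upperP u.
have Xt := expmx_trig pow2_dominates geometric_sums gs gt.
by rewrite (phiE _ _ Xt Xu) Xi.
Qed.

Theorem low_cbar i : (0 < n)%N -> (i <= n)%N ->
  low (cbar (n := N) i) = sum_principal_minors U (N - i) :> glpoly K N.
Proof.
move=> n0 ile.
apply: (low_eq pow2_dominates (d := N - i)); last exact: principal_neq0.
have := has_exp_principal (N - i) (has_exp_quotient pow2_dominates geometric_sums (n := N)).
apply: has_exp_near; apply: near0S (near0_small K N) => u us.
have gs := scaled_entries_small (@gst_lower_scaled K N) us.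
have [Yu Yi] := expmx_unit gs.
by rewrite cbar_principal ?(leqW ile) // Yi.
Qed.

End LowestTerms.

Section IntegrableSystem.
Variable K : numFieldType.
Hypothesis pow2_dominates : forall c e : K, 0 <= c -> 0 < e ->
  exists N, forall m, (N <= m)%N -> c <= e * 2 ^+ m.
Hypothesis geometric_sums : forall a : nat -> K,
  (forall k, `|a k| <= 4^-1 ^+ k) -> exists s, wsum a s.
Variable n : nat.
Hypothesis n0 : (0 < n)%N.
Local Notation N := n.+1.
Local Notation U := (coordmx K N).

Let flag_index := {p : 'I_n & 'I_p.+1}.
Let index := (flag_index + 'I_N)%type.

Let member (j : index) : glpoly K N :=
  match j with
  | inl a => low (phi (n := N) (tag a * n + tagged a).+1)
  | inr i => low (cbar (n := N) i)
  end.

Let flagP (a : flag_index) : exists e : bool,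
  member (inl a) = (-1) ^+ e * flag_poly K n (tag a) (tagged a).
Proof. by apply: low_phi => //; rewrite -ltnS. Qed.

(* Both sides are n (n + 1) / 2 for matrices of size n. *)
Lemma card_index : #|{: index}| = (N ^ 2 - (kks_rank K N)./2)%N.
Proof.
rewrite card_sum card_ord card_tagged kks_rank_eq.
have -> : sumn [seq #|'I_p.+1| | p : 'I_n] = (\sum_(p < n) p.+1)%N.
  rewrite sumnE big_map big_enum /=; apply: eq_bigr => p _; exact: card_ord.
have H : ((\sum_(p < n) p.+1) * 2 = n * n.+1)%N.
  elim: (n) => [|m IH]; first by rewrite big_ord0.
  by rewrite big_ord_recr /= mulnDl IH; lia.
have -> : (N * N - N = (\sum_(p < n) p.+1) * 2)%N by rewrite H; nia.
rewrite muln2 doubleK -mulnn; move: H; set x := (\sum_(p < n) _)%N => H.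
by nia.
Qed.

Lemma member_commute (j k : index) : kks (member j) (member k) = 0.
Proof.
have casimir f (i : 'I_N) : kks f (member (inr i)) = 0.
  have il : (i <= n)%N by rewrite -ltnS.
  rewrite /member (low_cbar pow2_dominates geometric_sums n0 il).
  rewrite -(coef_det_X_add U (leqW il)); exact: kks_char_coef.
case: j k => [a|i] [b|i'] //; last by rewrite kksC casimir oppr0.
have [e ->] := flagP a; have [e' ->] := flagP b.
have minorE (c : flag_index) : flag_poly K n (tag c) (tagged c) =
    flag_minor K ord0 (fun h : 'I_(n - tag c) => inord ((tagged c).+1 + h)).
  by apply: flag_polyE; [exact: ltn_ord | rewrite -ltnS; exact: ltn_ord].
have row_neq0 (c : flag_index) (h : 'I_(n - tag c)) :
    inord ((tagged c).+1 + h) != ord0 :> 'I_N.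
  have := ltn_ord h; have := ltn_ord (tagged c); have := ltn_ord (tag c).
  by rewrite -val_eqE /= => *; rewrite inordK //; lia.
by rewrite kks_signl kks_signr !minorE kks_flag_minors ?mulr0 // => h; exact: row_neq0.
Qed.

(** Every family of nonzero values is taken by the functions at some point, hence no
    polynomial relation can hold between them. *)
Lemma member_values (v : index -> K) : (forall j, v j != 0) ->
  exists u : 'M[K]_N, forall j, gleval (member j) u = v j.
Proof.
move=> v0; have /choice[e He] := flagP.
pose d (p i : nat) : K :=
  if [pick a : flag_index | (tag a == p :> nat) && (tagged a == i :> nat)] is Some a
  then (-1) ^+ e a * v (inl a) else 1.
have d0 p i : d p i != 0.
  by rewrite /d; case: pickP => [a _|_]; rewrite ?oner_eq0 // mulf_neq0 ?signr_eq0.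
have dE (a : flag_index) : d (tag a) (tagged a) = (-1) ^+ e a * v (inl a).
  rewrite /d; case: pickP => [b /andP[/eqP]|/(_ a)]; last by rewrite !eqxx.
  case: a b => [p i] [p' i'] /= /val_inj E; subst p'.
  by move=> /eqP /val_inj ->.
have [u [Hd Hc]] := realize_system (fun i => v (inr (inord i))) n0 d0.
exists u => -[a|i].
  have an : (tag a < n)%N by [].
  have ai : (tagged a <= tag a)%N by rewrite -ltnS.
  rewrite He glevalM gleval_flag_poly // Hd // dE.
  by rewrite /gleval rmorphXn rmorphN rmorph1 mulrA -signr_addb addbb mul1r.
have il : (i <= n)%N by rewrite -ltnS.
by rewrite /member (low_cbar pow2_dominates geometric_sums n0 il) gleval_principal Hc // inord_val.
Qed.

Lemma alg_indep_of_values M (s : M.-tuple (glpoly K N)) :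
  (forall v : 'I_M -> K, (forall k, v k != 0) ->
    exists u, forall k, gleval (tnth s k) u = v k) -> alg_indep s.
Proof.
move=> sv Q Qs; apply/eqP; apply: contraT => /mpoly_nonvanishing[v v0].
have [u Hu] := sv v v0.
rewrite -(meval_eq Q (Hu : (fun k => gleval (tnth s k) u) =1 v)).
by rewrite -comp_mpoly_meval Qs meval0 eqxx.
Qed.

Theorem integrable_system :
  polynomial_integrable_system [set f : glpoly K N | exists j, f = member j].
Proof.
have [s [sm si]] : exists s : (N ^ 2 - (kks_rank K N)./2).-tuple (glpoly K N),
    (forall f, f \in s <-> exists j, f = member j) /\ alg_indep s.
  rewrite -card_index.
  exists [tuple member (enum_val k) | k < #|{: index}|]; split=> [f|].
    split=> [/tnthP[k ->]|[j ->]]; first by exists (enum_val k); rewrite tnth_mktuple.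
    by apply/tnthP; exists (enum_rank j); rewrite tnth_mktuple enum_rankK.
  apply: alg_indep_of_values => v v0.
  have [u Hu] := member_values (fun j => v0 (enum_rank j)).
  by exists u => k; rewrite tnth_mktuple Hu enum_valK.
exists s; split=> //.
  by apply/seteqP; split=> f /= /sm.
by move=> f g [j ->] [k ->]; exact: member_commute.
Qed.

End IntegrableSystem.

Theorem theorem7p10 (R : realType) (n : nat) (hn : (2 <= n)%N) :
  polynomial_integrable_system
    ([set q : glpoly R[i] n | exists p i : nat,
        [/\ (p <= n - 2)%N, (1 <= i <= n - 1)%N, (i <= p + 1)%N &
            q = low (phi (n := n) (p * (n - 1) + i))]]
     `|`
     [set q : glpoly R[i] n | exists i : nat,
        (0 <= i <= n - 1)%N /\ q = low (cbar (n := n) i)])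
  /\
  (forall p i : nat, (p <= n - 2)%N -> (1 <= i <= n - 1)%N -> (i <= p + 1)%N ->
     exists e : bool, forall u : 'M[R[i]]_n,
       gleval (low (phi (n := n) (p * (n - 1) + i))) u =
       (-1) ^+ e * Delta (Fmx u) (i + 1) (n - p + i - 1) 1)
  /\
  (forall i : nat, (0 <= i <= n - 1)%N -> forall u : 'M[R[i]]_n,
     gleval (low (cbar (n := n) i)) u = sum_principal_minors u (n - i)).
Proof.
have pow2 := @complex_pow2_dominates R; have geom := @geometric_wsum R.
case: n hn => [//|n] hn; have n0 : (0 < n)%N by [].
have idx p i : (p * (n.+1 - 1) + i.+1 = (p * n + i).+1)%N by rewrite subn1 addnS.
split; [|split].
- have := integrable_system pow2 geom n0; congr polynomial_integrable_system.
  apply/seteqP; split=> f /=.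
    move=> [[a|i] ->]; [left|right].
      have h1 := ltn_ord (tag a); have h2 := ltn_ord (tagged a).
      exists (tag a), (tagged a).+1; rewrite idx; split=> //; lia.
    by exists i; split=> //; rewrite subn1 -ltnS.
  move=> [[p [[|i] [h1 h2 h3 ->]]]|[i [h ->]]]; first by [].
    have pn : (p < n)%N by lia.
    have ip : (i < (Ordinal pn).+1)%N by rewrite /=; lia.
    exists (inl (existT (fun q : 'I_n => 'I_q.+1) (Ordinal pn) (Ordinal ip))).
    by rewrite idx.
  have ilt : (i < n.+1)%N by lia.
  by exists (inr (Ordinal ilt)).
- move=> p [//|i] h1 h2 h3; rewrite idx.
  have pn : (p < n)%N by lia.
  have ip : (i <= p)%N by lia.
  have [e ->] := low_phi pow2 geom pn ip.
  exists e => u; rewrite glevalM gleval_flag_poly // addn1; congr (_ * _).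
  by rewrite /gleval rmorphXn rmorphN rmorph1.
- move=> i h u; have ile : (i <= n)%N by lia.
  by rewrite (low_cbar pow2 geom n0 ile) gleval_principal.
Qed.
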